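(* For each $w\in\mathfrak{S}_n$, the map $f\colon P_{T_w}\to I(w)$ is Birkhoff–Priestley dual to the pruned tree map $p\colon[e,w]_{\mathscr{E}_n}\to J(P_{T_w})$. That is, the diagram $$[e,w]_{\mathscr{E}_n}\;\cong\;J(I(w))\xrightarrow{\;J(f)\;}J(P_{T_w})\;\cong\;[\mathrm{RCT}(n+1),T_w]_{\mathscr{C}_{n+1}}$$ composes to the restriction $p|_{[e,w]_{\mathscr{E}_n}}$; equivalently, for every $v\in[e,w]_{\mathscr{E}_n}$ the set $f^{-1}(I(v))$ is the order ideal of $P_{T_w}$ corresponding to the tree $p(v)\le T_w$. In particular, $p\colon\mathscr{E}_n\to\mathscr{C}_{n+1}$ becomes a lattice morphism when restricted to any interval in $\mathscr{E}_n$.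
   Context: Comb poset. $\mathbb{T}_m$ is the set of all full plane binary trees with $m$ leaves (every internal vertex has exactly a left and a right child); leaves are labeled $a_1,\ldots,a_m$ from left to right. For $T\in\mathbb{T}_m$, the reduced parenthesization $RP_T$ is the set of all subsets of $\{a_1,\ldots,a_m\}$ which are leaf sets of the subtrees of $T$ rooted at vertices of $T$ and which do not contain $a_m$. The comb poset $\mathscr{C}_m$ is $\mathbb{T}_m$ ordered by $T_1\le T_2$ iff $RP_{T_1}\subseteq RP_{T_2}$; its least element is the right comb tree $\mathrm{RCT}(m)=a_1(a_2(\cdots(a_{m-1}a_m)\cdots))$. Every interval of $\mathscr{C}_m$ is a distributive lattice. Edelman's poset. $\mathscr{E}_n$ is the partial order on $\mathfrak{S}_n$ (one-line notation) that is the transitive closure of the covering relation: $\sigma$ covers $\tau$ if $\sigma$ is obtained from $\tau$ by transposing two adjacent entries $\tau(j)<\tau(j+1)$, and, after the transposition, nothing to the left of $\tau(j+1)$ in $\sigma$ is greater than $\tau(j+1)$. $e$ is the identity permutation and $[e,w]_{\mathscr{E}_n}=\{v: v\le_{\mathscr{E}_n}w\}$. Intervals of $\mathscr{E}_n$ are distributive lattices. Inversion poset. $I(\sigma)=\{(j,i): j>i,\ \sigma^{-1}(j)<\sigma^{-1}(i)\}$, ordered by $(k,\ell)\ge(j,i)$ iff $k\ge j$ and $\sigma^{-1}(\ell)\le\sigma^{-1}(i)$. For a poset $P$, $J(P)$ is the lattice of order ideals of $P$ ordered by inclusion. The isomorphism $[e,w]_{\mathscr{E}_n}\cong J(I(w))$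 (Edelman) is $v\mapsto I(v)$. Pruned tree map. Deleting the leaves (''pruning'') is a bijection from $\mathbb{T}_{n+1}$ to plane binary trees with $n$ vertices (each vertex having at most one left and at most one right child), called pruned trees. $p$ is defined recursively on sequences of distinct numbers: for a one-element sequence $p(x)$ is a single vertex (the empty sequence gives the empty tree); for $x=(x_1,\ldots,x_n)$, $p(x)$ has a root with left subtree $p(x_<)$ and right subtree $p(x_>)$, where $x_<$ (resp. $x_>$) is the subsequence of entries of $x$ less than (resp. greater than) $x_1$, in the order of $x$. Labeling the root of $p(x)$ by $x_1$ recursively gives the in-order labeling of the vertices by $1,\ldots,n$. Put $T_w=p(w)$; via unpruning it is regarded as an element of $\mathbb{T}_{n+1}$. Reduced pruned poset. For $T\in\mathbb{T}_{n+1}$, $P_T$ is the poset of non-singleton elements of $RP_T$ ordered by inclusion. Equivalently, it consists of the vertices of the pruned tree of $T$ not on the right arm (the right arm consists of the vertices lying in the left subtree of no other vertex), where $k\le j$ iff $k$ lies in the subtree rooted at $j$; elements of $P_{T_w}$ are named by their labels in $T_w$. The isomorphism $J(P_{T})\cong[\mathrm{RCT}(n+1),T]_{\mathscr{C}_{n+1}}$ sends an ideal $I$ to the tree $S$ whose $RP_S$ has exactly the elements of $I$ as its non-singleton members. The map $f\colon P_{T_w}\to I(w)$ is $f(j)=(i,j)$, where $i$ is the smallest label of a vertex of $T_w$ such that $j$ lies in the left subtree of $i$; it is order-preserving. Birkhoff–Priestley dual. For an order-preserving map $\phi\colon P_1\to P_2$, $J(\phi)\colon J(P_2)\to J(P_1)$,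 $J(\phi)(I)=\phi^{-1}(I)$; it is a lattice morphism. *)

(* Defs.v *)
From HB Require Import structures.
From mathcomp Require Import all_boot all_fingroup.

Set Implicit Arguments.
Unset Strict Implicit.
Unset Printing Implicit Defensive.

(** The numbers 1, ..., n and the leaves a_1, ..., a_m are indexed from 0, by
    ['I_n] and ['I_m] respectively. *)

(** ** Finite posets

    A poset is given by a carrier [A], a predicate on an ambient type, together
    with a relation [le], of which only the restriction to [A] matters. *)

Section Posets.
Variables X Y : Type.
Implicit Types (A : {pred X}) (B : {pred Y}) (le : rel X) (leY : rel Y).

Definition interval le (a b : X) : {pred X} := [pred x | le a x && le x b].

Definition order_preserving A le B leY (phi : X -> Y) : Prop :=
  (forall x, x \in A -> phi x \in B) /\
  (forall x y, x \in A -> y \in A -> le x y -> leY (phi x) (phi y)).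

Definition order_iso A le B leY (phi : X -> Y) : Prop :=
  [/\ forall x, x \in A -> phi x \in B,
      forall x y, x \in A -> y \in A -> phi x = phi y -> x = y,
      forall y, y \in B -> exists2 x, x \in A & phi x = y
    & forall x y, x \in A -> y \in A -> leY (phi x) (phi y) = le x y].

Definition is_meet A le (x y z : X) : Prop :=
  [/\ z \in A, le z x, le z y
    & forall t, t \in A -> le t x -> le t y -> le t z].

Definition is_join A le (x y z : X) : Prop :=
  [/\ z \in A, le x z, le y z
    & forall t, t \in A -> le x t -> le y t -> le z t].

Definition is_lattice A le : Prop :=
  forall x y, x \in A -> y \in A ->
    (exists z, is_meet A le x y z) /\ (exists z, is_join A le x y z).

End Posets.

Definition lattice_morphism (X Y : Type) (A : {pred X}) (le : rel X)
    (B : {pred Y}) (leY : rel Y) (phi : X -> Y) : Prop :=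
  [/\ is_lattice A le, is_lattice B leY,
      forall x, x \in A -> phi x \in B,
      forall x y z, x \in A -> y \in A ->
        is_meet A le x y z -> is_meet B leY (phi x) (phi y) (phi z)
    & forall x y z, x \in A -> y \in A ->
        is_join A le x y z -> is_join B leY (phi x) (phi y) (phi z)].

(** [J P le] is ordered by inclusion. *)
Definition J (X : finType) (P : {set X}) (le : rel X) : {set {set X}} :=
  [set D : {set X} | (D \subset P) &&
     [forall x in D, forall y in P, le y x ==> (y \in D)]].

Definition inclusion (X : finType) : rel {set X} :=
  fun D E => D \subset E.

(** The dual [J(phi)] of a map [phi] defined on the poset [P]. *)
Definition Jmap (X Y : finType) (P : {set X}) (phi : X -> Y) (D : {set Y})
  : {set X} := [set x in P | phi x \in D].

(** ** The comb poset *)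

Inductive bintree : Type := Leaf | Node of bintree & bintree.

Fixpoint leaves (t : bintree) : nat :=
  if t is Node l r then leaves l + leaves r else 1.

Record fulltree (m : nat) : Type :=
  FullTree { tree_of :> bintree; _ : leaves tree_of == m }.

HB.instance Definition _ m := [isSub for @tree_of m].

(** The leaves of [t], when [t] is the subtree of a tree with [m] leaves whose
    leftmost leaf has index [k]. *)
Definition leaf_range (m k : nat) (t : bintree) : {set 'I_m} :=
  [set i : 'I_m | k <= i < k + leaves t].

(** The leaf sets of all the subtrees of [t], with [m] and [k] as above. *)
Fixpoint clades (m k : nat) (t : bintree) : seq {set 'I_m} :=
  leaf_range m k t ::
  (if t is Node l r then clades m k l ++ clades m (k + leaves l) r else [::]).

Definition RP (n : nat) (t : fulltree n.+1) : {set {set 'I_n.+1}} :=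
  [set A : {set 'I_n.+1} | (A \in clades n.+1 0 t) && (ord_max \notin A)].

Definition comb_le (n : nat) : rel (fulltree n.+1) :=
  fun t1 t2 => RP t1 \subset RP t2.

Fixpoint right_comb (n : nat) : bintree :=
  if n is n'.+1 then Node Leaf (right_comb n') else Leaf.

Lemma leaves_right_comb n : leaves (right_comb n) == n.+1.
Proof. by elim: n => //= n /eqP ->. Qed.

Definition RCT (n : nat) : fulltree n.+1 := FullTree (leaves_right_comb n).

(** The carrier of the reduced pruned poset, which is ordered by inclusion. *)
Definition reduced (n : nat) (t : fulltree n.+1) : {set {set 'I_n.+1}} :=
  [set A in RP t | #|A| != 1].

(** ** Edelman's poset *)

(** The one-line notation of [s] is [s 0, s 1, ...], and
    [(tperm j j' * s)%g] is [s] with its entries in positions [j] and [j']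
    transposed. *)
Definition edelman_cover (n : nat) : rel {perm 'I_n} := fun t s =>
  [exists j : 'I_n, exists j' : 'I_n,
    [&& j' == j.+1 :> nat, t j < t j', s == (tperm j j' * t)%g
      & [forall i : 'I_n, (i < j) ==> ~~ (t j' < s i)]]].

Definition edelman_le (n : nat) : rel {perm 'I_n} := connect (@edelman_cover n).

(** ** The inversion poset *)

Definition inversions (n : nat) (s : {perm 'I_n}) : {set 'I_n * 'I_n} :=
  [set q : 'I_n * 'I_n | (q.2 < q.1) && (s^-1%g q.1 < s^-1%g q.2)].

Definition inversion_le (n : nat) (s : {perm 'I_n}) : rel ('I_n * 'I_n) :=
  fun q q' => (q.1 <= q'.1) && (s^-1%g q'.2 <= s^-1%g q.2).

(** ** Pruned trees and the pruned tree map *)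

(** Plane binary trees with labelled vertices; [Empty] stands for the absence
    of a child. *)
Inductive ltree (T : Type) : Type :=
  Empty | Vertex of ltree T & T & ltree T.
Arguments Empty {T}.

Fixpoint unprune (T : Type) (L : ltree T) : bintree :=
  if L is Vertex l _ r then Node (unprune l) (unprune r) else Leaf.

Fixpoint labels (T : Type) (L : ltree T) : seq T :=
  if L is Vertex l x r then labels l ++ x :: labels r else [::].

Definition left_child (T : Type) (L : ltree T) : ltree T :=
  if L is Vertex l _ _ then l else Empty.

(** The subtree rooted at the vertex labelled [j]. *)
Fixpoint subtree (T : eqType) (L : ltree T) (j : T) : ltree T :=
  if L is Vertex l x r then
    if j == x then L else if j \in labels l then subtree l j else subtree r j
  else Empty.

(** The leaf set of the subtree of [unprune L] rooted at the vertex labelled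
    [j], where [m] and [k] are as in [leaf_range]. *)
Fixpoint vertex_leaves (T : eqType) (m k : nat) (L : ltree T) (j : T)
  : {set 'I_m} :=
  if L is Vertex l x r then
    if j == x then leaf_range m k (unprune L)
    else if j \in labels l then vertex_leaves m k l j
    else vertex_leaves m (k + leaves (unprune l)) r j
  else set0.

(** [fuel] bounds the recursion depth; [pruned_cons] is the defining equation
    of the pruned tree map. *)
Fixpoint pruned_rec (n fuel : nat) (x : seq 'I_n) : ltree 'I_n :=
  match fuel, x with
  | fuel'.+1, a :: s =>
    Vertex (pruned_rec fuel' [seq b : 'I_n <- s | b < a]) a
           (pruned_rec fuel' [seq b : 'I_n <- s | a < b])
  | _, _ => Empty
  end.

Definition pruned (n : nat) (x : seq 'I_n) : ltree 'I_n :=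
  pruned_rec (size x) x.

Lemma pruned_rec_fuel n k k' (x : seq 'I_n) :
  size x <= k -> size x <= k' -> pruned_rec k x = pruned_rec k' x.
Proof.
elim: k k' x => [|k IH] [|k'] [|a s] //= sk sk'.
by congr Vertex; apply: IH; rewrite size_filter (leq_trans (count_size _ _)).
Qed.

Lemma pruned_cons n (a : 'I_n) (s : seq 'I_n) :
  pruned (a :: s) =
  Vertex (pruned [seq b : 'I_n <- s | b < a]) a
         (pruned [seq b : 'I_n <- s | a < b]).
Proof.
by congr Vertex; apply: pruned_rec_fuel; rewrite // size_filter count_size.
Qed.

Lemma leaves_pruned n (x : seq 'I_n) :
  uniq x -> leaves (unprune (pruned x)) = (size x).+1.
Proof.
have [k] := ubnP (size x); elim: k x => // k IH [|a s] //.
rewrite pruned_cons => lek /= /andP[a_s s_uniq].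
have le_k (P : pred 'I_n) : size (filter P s) < k.
  by rewrite size_filter (leq_ltn_trans (count_size _ _)).
rewrite !IH ?filter_uniq // addSn addnS !size_filter; congr _.+2.
rewrite -(count_predC (fun b : 'I_n => b < a) s); congr (_ + _).
apply: eq_in_count => b bs; rewrite /= -leqNgt ltn_neqAle.
by case: eqP => // /val_inj ab; rewrite ab bs in a_s.
Qed.

Definition one_line (n : nat) (w : {perm 'I_n}) : seq 'I_n :=
  [seq w i | i <- enum 'I_n].

Definition ptree (n : nat) (w : {perm 'I_n}) : ltree 'I_n :=
  pruned (one_line w).

Lemma leaves_ptree n (w : {perm 'I_n}) :
  leaves (unprune (ptree w)) == n.+1.
Proof.
rewrite leaves_pruned; first by rewrite size_map size_enum_ord.
by rewrite (map_inj_uniq perm_inj) enum_uniq.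
Qed.

(** The pruned tree map [p] with values in the comb poset; [T_w] is [ptmap w]. *)
Definition ptmap (n : nat) (w : {perm 'I_n}) : fulltree n.+1 :=
  FullTree (leaves_ptree w).

(** ** The reduced pruned poset of [T_w] on the labels of the vertices *)

Section PrunedPoset.
Variables (n : nat) (w : {perm 'I_n}).

Definition in_left (i j : 'I_n) : bool :=
  j \in labels (left_child (subtree (ptree w) i)).

(** The vertices that are not on the right arm. *)
Definition P_lab : {set 'I_n} := [set j | [exists i, in_left i j]].

Definition P_le : rel 'I_n := fun k j => k \in labels (subtree (ptree w) j).

(** The element of [reduced (ptmap w)] named by the label [j]. *)
Definition named (j : 'I_n) : {set 'I_n.+1} :=
  vertex_leaves n.+1 0 (ptree w) j.

(** The default value [j] of [arg min] is only returned outside [P_lab]. *)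
Definition fdual (j : 'I_n) : 'I_n * 'I_n :=
  ([arg min_(i < j | in_left i j) i], j).

End PrunedPoset.

(* Main.v *)
(** The vertex k lies in the subtree of T_w rooted at j iff no value between k
    and j precedes j in w; hence j is off the right arm iff some i > j precedes
    j, and f(j) = (i, j) for the least such i. If v <= w in Edelman's poset, i.e. if I(v) is an ideal of I(w), then
    j is off the right arm of T_v iff f(j) is in I(v), and in that case the
    subtrees of T_v and T_w at j have the same leaves: (j, y) <= f(j) for each
    (j, y) in I(w), and no value between j and i precedes j. So f^-1(I(v)) is
    the ideal of the tree T_v. Finally [e, w] and [RCT, T_w] are represented by
    families of sets closed under union and intersection, and taking preimages
    under f preserves both. *)

Require Import Defs.
From mathcomp Require Import all_boot all_fingroup zify.

Set Implicit Arguments.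
Unset Strict Implicit.
Unset Printing Implicit Defensive.

(** The map [J(f)] need not be onto: with labels counted from 1 and w = 4 2 3 1, the ideal {3} of
    P_{T_w} is not f^-1(I(v)) for any v below w, since f(1) <= f(3). So the isomorphism of
    J(P_{T_w}) with the comb interval cannot be deduced from the one for [e, w]: the permutation
    whose tree realizes a given ideal need not lie below w. Conversely, that a tree below T_w gives
    an ideal is not visible from the inclusion of the sets RP; it holds because the leaf sets of a
    full binary tree form a maximal family, so that two comparable trees agree inside every leaf set
    that they share. On the Edelman side, I(v) and I(w) carry different orders, each reading
    positions in its own permutation, so moving ideals between them takes an argument in each
    direction. An interval [u, w] is studied through ideals attached to w alone. *)

Lemma subset_imset_inj (X Y : finType) (f : X -> Y) (D E : {set X}) :
  injective f -> (f @: D \subset f @: E) = (D \subset E).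
Proof.
move=> f_inj; apply/idP/idP=> [/subsetP sub_f|]; last exact: imsetS.
by apply/subsetP=> x Dx; rewrite -(mem_imset _ _ f_inj) sub_f // imset_f.
Qed.

(** * Order ideals, and lattices represented by sets *)

Section Ideals.
Variables (X : finType) (P : {set X}) (le : rel X).
Implicit Types D E : {set X}.

Lemma idealP D :
  reflect (D \subset P /\
           forall x y, x \in D -> y \in P -> le y x -> y \in D)
    (D \in J P le).
Proof.
rewrite inE; apply: (iffP andP) => -[sub_D ideal_D]; split=> //.
  by move=> x y Dx Py; apply/implyP; move: y Py; apply/forall_inP; move: x Dx;
    apply/forall_inP.
by do 2![apply/forall_inP=> ? ?]; apply/implyP; apply: ideal_D.
Qed.

Lemma idealI D E : D \in J P le -> E \in J P le -> D :&: E \in J P le.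
Proof.
move=> /idealP[sub_D ideal_D] /idealP[_ ideal_E]; apply/idealP; split.
  exact: subset_trans (subsetIl _ _) sub_D.
move=> x y /setIP[Dx Ex] Py le_yx.
apply/setIP; split; first exact: ideal_D Dx Py le_yx.
exact: ideal_E Ex Py le_yx.
Qed.

Lemma idealU D E : D \in J P le -> E \in J P le -> D :|: E \in J P le.
Proof.
move=> /idealP[sub_D ideal_D] /idealP[sub_E ideal_E]; apply/idealP; split.
  by rewrite subUset sub_D.
move=> x y /setUP[Dx|Ex] Py le_yx; apply/setUP.
  by left; apply: ideal_D Dx Py le_yx.
by right; apply: ideal_E Ex Py le_yx.
Qed.

End Ideals.

Lemma Jmap_ideal (X Y : finType) (P : {set X}) (leX : rel X) (Q : {set Y})
    (leY : rel Y) (phi : X -> Y) (D : {set Y}) :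
  order_preserving (mem P) leX (mem Q) leY phi ->
  D \in J Q leY -> Jmap P phi D \in J P leX.
Proof.
move=> [phi_Q phi_le] /idealP[sub_D ideal_D]; apply/idealP; split.
  by apply/subsetP=> x; rewrite inE => /andP[].
move=> x y; rewrite !inE => /andP[Px Dx] Py le_yx; rewrite Py.
exact: ideal_D Dx (phi_Q _ Py) (phi_le _ _ Py Px le_yx).
Qed.

Lemma JmapI (X Y : finType) (P : {set X}) (phi : X -> Y) (D E : {set Y}) :
  Jmap P phi (D :&: E) = Jmap P phi D :&: Jmap P phi E.
Proof. by apply/setP=> x; rewrite !inE andbACA andbb. Qed.

Lemma JmapU (X Y : finType) (P : {set X}) (phi : X -> Y) (D E : {set Y}) :
  Jmap P phi (D :|: E) = Jmap P phi D :|: Jmap P phi E.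
Proof. by apply/setP=> x; rewrite !inE andb_orr. Qed.

Section SetLattice.
Variables (X : Type) (Z : finType) (A : {pred X}) (le : rel X).
Variable h : X -> {set Z}.
Hypothesis le_h : forall x y, x \in A -> y \in A -> le x y = (h x \subset h y).
Hypothesis hI : forall x y, x \in A -> y \in A ->
  exists2 z, z \in A & h z = h x :&: h y.
Hypothesis hU : forall x y, x \in A -> y \in A ->
  exists2 z, z \in A & h z = h x :|: h y.

(** By [hI] some element of [A] realizes the intersection; being a lower bound, it lies below the
    meet, whose own set is contained in the intersection. Meets thus become set equations, which
    [JmapI] can transport. *)
Lemma is_meet_set x y z : x \in A -> y \in A ->
  is_meet A le x y z <-> z \in A /\ h z = h x :&: h y.
Proof.
move=> Ax Ay; split=> [[Az le_zx le_zy max_z]|[Az hz]].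
  split=> //; have [t At ht] := hI Ax Ay.
  apply/eqP; rewrite eqEsubset subsetI -!le_h // le_zx le_zy -ht -le_h //=.
  by apply: max_z; rewrite // le_h // ht ?subsetIl ?subsetIr.
split=> // [||t At]; rewrite ?le_h // hz ?subsetIl ?subsetIr //.
by rewrite subsetI => -> ->.
Qed.

Lemma is_join_set x y z : x \in A -> y \in A ->
  is_join A le x y z <-> z \in A /\ h z = h x :|: h y.
Proof.
move=> Ax Ay; split=> [[Az le_xz le_yz min_z]|[Az hz]].
  split=> //; have [t At ht] := hU Ax Ay.
  apply/eqP; rewrite eqEsubset subUset -!le_h // le_xz le_yz -ht -le_h //=.
  rewrite andbT.
  by apply: min_z; rewrite // le_h // ht ?subsetUl ?subsetUr.
split=> // [||t At]; rewrite ?le_h // hz ?subsetUl ?subsetUr //.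
by rewrite subUset => -> ->.
Qed.

Lemma is_lattice_set : is_lattice A le.
Proof.
move=> x y Ax Ay; split.
  by have [z Az hz] := hI Ax Ay; exists z; apply/is_meet_set.
by have [z Az hz] := hU Ax Ay; exists z; apply/is_join_set.
Qed.

End SetLattice.

(** * Pruned trees of words: subtrees and their leaf sets *)

Lemma leaves_gt0 t : 0 < leaves t.
Proof. by elim: t => //= l IHl r _; rewrite ltn_addr. Qed.

Lemma card_leaf_range m k t :
  k + leaves t <= m -> #|leaf_range m k t| = leaves t.
Proof.
move=> le_m; rewrite cardE -(size_map val) -[RHS](size_iota k).
apply: perm_size; apply: uniq_perm; rewrite ?iota_uniq //.
  by rewrite (map_inj_uniq val_inj) enum_uniq.
move=> i; rewrite mem_iota; apply/mapP/idP => [[j]|ik].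
  by rewrite mem_enum inE => jk ->.
have ltim : i < m by lia.
by exists (Ordinal ltim); rewrite // mem_enum inE.
Qed.

Section PrunedTree.
Variable n : nat.
Implicit Types (x s : seq 'I_n) (a i j y : 'I_n).

Lemma pruned_ind (P : seq 'I_n -> Type) :
  P [::] ->
  (forall a s, P [seq b : 'I_n <- s | b < a] -> P [seq b : 'I_n <- s | a < b] ->
     P (a :: s)) ->
  forall x, P x.
Proof.
move=> P0 PS x; have [m] := ubnP (size x); elim: m x => // m IH [|a s] //= sm.
by apply: PS; apply: IH; rewrite size_filter (leq_ltn_trans (count_size _ _)).
Qed.

Lemma mem_labels_pruned x : labels (pruned x) =i x.
Proof.
elim/pruned_ind: x => [|a s IHl IHr] i //.
rewrite pruned_cons /= mem_cat inE IHl IHr !mem_filter !inE.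
have [->|] := eqVneq i a; first by rewrite orbT.
by rewrite -val_eqE /= neq_ltn => /orP[] h; rewrite h ltnNge (ltnW h) ?orbF.
Qed.

Variable pos : 'I_n -> nat.

(** [pos] is fixed once and is not the index in [x], so that the property passes to the subsequences
    on which [pruned] recurses. *)
Definition pos_sorted x := pairwise (fun i j => pos i < pos j) x.

Lemma pos_sorted_filter (p : pred 'I_n) x :
  pos_sorted x -> pos_sorted (filter p x).
Proof. exact: pairwise_filter. Qed.

(** The root [a] precedes all other entries. If [i] and [j] are on different sides of [a], then [a]
    lies between them and violates the condition; if they are on the same side, so is everything
    between them, and the induction hypothesis for that side applies. *)
Lemma subtreeP x i j : pos_sorted x -> j \in x ->
  reflect (i \in x /\ forall y, y \in x ->
             (i <= y <= j) || (j <= y <= i) -> pos j <= pos y)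
    (i \in labels (subtree (pruned x) j)).
Proof.
elim/pruned_ind: x i j => [|a s IHl IHr] i j //.
rewrite pruned_cons => /= /andP[/allP min_a sorted_s] jx.
rewrite mem_labels_pruned mem_filter.
have le_a y : y \in a :: s -> pos a <= pos y.
  by rewrite inE => /predU1P[-> //|/min_a/ltnW].
have [eq_ja|neq_ja] := eqVneq j a.
  rewrite eq_ja -pruned_cons mem_labels_pruned.
  by apply: (iffP idP) => [ix|[]//]; split=> // y /le_a.
have js : j \in s by move: jx; rewrite inE (negPf neq_ja).
have lt_aj := min_a _ js.
(* [p] selects the side of [a] that contains [j]; leaving that side means having [a] weakly between
   oneself and [j]. This treats the left and the right subtree at once. *)
have branch (p : pred 'I_n) : p j ->
    (forall y, ~~ p y = (y <= a <= j) || (j <= a <= y)) ->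
    (i \in filter p s /\ forall y, y \in filter p s ->
       (i <= y <= j) || (j <= y <= i) -> pos j <= pos y) <->
    (i \in a :: s /\ forall y, y \in a :: s ->
       (i <= y <= j) || (j <= y <= i) -> pos j <= pos y).
  move=> pj pN; have pa : p a = false by apply/negbTE; rewrite pN; lia.
  split=> -[]; rewrite mem_filter.
    case/andP=> pi iS H; split=> [|y]; first by rewrite inE iS orbT.
    rewrite inE => /predU1P[->|ys] yij; first by move: (pN i); rewrite pi; lia.
    by apply: H => //; rewrite mem_filter ys andbT; move: (pN y) (pN i); lia.
  move=> ix H; have pi : p i.
    by rewrite -[p i]negbK pN; apply/negP=> /(H a (mem_head _ _)); lia.
  have neq_ia : i != a by apply: contraTneq pi => ->; rewrite pa.
  split=> [|y]; first by move: ix; rewrite inE (negPf neq_ia) pi.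
  by rewrite mem_filter => /andP[_ ys]; apply: H; rewrite inE ys orbT.
rewrite js andbT; case: ifPn => ltja.
  apply: (equivP (IHl _ _ (pos_sorted_filter _ sorted_s) _)).
    by rewrite mem_filter ltja.
  by apply: branch => // y; lia.
have ltaj : a < j by move: neq_ja; rewrite -val_eqE /=; lia.
apply: (equivP (IHr _ _ (pos_sorted_filter _ sorted_s) _)).
  by rewrite mem_filter ltaj.
by apply: branch => // y; lia.
Qed.

Lemma mem_left_subtree x i j : pos_sorted x -> i \in x ->
  (j \in labels (left_child (subtree (pruned x) i))) =
  (j < i) && (j \in labels (subtree (pruned x) i)).
Proof.
elim/pruned_ind: x => [|a s IHl IHr] //.
rewrite pruned_cons => /= /andP[_ sorted_s] ix.
rewrite mem_labels_pruned mem_filter.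
have [->|neq_ia] := eqVneq i a.
  rewrite /= mem_cat inE !mem_labels_pruned !mem_filter -val_eqE /=.
  by case: ltngtP; rewrite ?andbF ?orbF.
have iS : i \in s by move: ix; rewrite inE (negPf neq_ia).
have {}neq_ia : (i < a) || (a < i) by rewrite -neq_ltn val_eqE.
rewrite iS andbT; case: ifPn => ltia.
  by apply: IHl; rewrite ?pos_sorted_filter // mem_filter ltia.
by apply: IHr; rewrite ?pos_sorted_filter // mem_filter iS andbT; lia.
Qed.

(** The offset [k] is also the index of the leftmost leaf of [pruned x], because in in-order leaf
    [l] comes just before label [l]. *)
Definition spans (k : nat) x := forall y, (y \in x) = (k <= y < k + size x).

Lemma spans_split k a s : uniq (a :: s) -> spans k (a :: s) ->
  [/\ k + size [seq b : 'I_n <- s | b < a] = a,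
      spans k [seq b : 'I_n <- s | b < a] &
      spans a.+1 [seq b : 'I_n <- s | a < b] /\
      a.+1 + size [seq b : 'I_n <- s | a < b] = k + size (a :: s)].
Proof.
move=> uniq_as sp; have [a_s uniq_s] := andP uniq_as.
have szl : size [seq b : 'I_n <- s | b < a] = a - k.
  rewrite -(size_map val) -[RHS](size_iota k); apply: perm_size.
  apply: uniq_perm; rewrite ?iota_uniq ?(map_inj_uniq val_inj) ?filter_uniq //.
  have := sp a; rewrite mem_head => /esym/andP[leka ltak] z.
  rewrite mem_iota subnKC //; apply/mapP/andP => [[y]|[lekz ltza]].
    rewrite mem_filter => /andP[ltya ys] ->; split=> //.
    by have := sp y; rewrite inE ys orbT => /esym/andP[].
  have ltzn : z < n by apply: ltn_trans (ltn_ord a).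
  exists (Ordinal ltzn) => //; rewrite mem_filter /= ltza /=.
  have := sp (Ordinal ltzn); rewrite inE -val_eqE /= [z == a]ltn_eqF //=.
  by move: ltak => /=; lia.
have szr : size [seq b : 'I_n <- s | b < a] +
           size [seq b : 'I_n <- s | a < b] = size s.
  rewrite !size_filter -(count_predC (fun b : 'I_n => b < a) s); congr (_ + _).
  apply: eq_in_count => b bs; rewrite /= -leqNgt ltn_neqAle.
  by case: eqP => // /val_inj ab; rewrite ab bs in a_s.
have := sp a; rewrite mem_head /= => /esym ka.
have memE y : y != a -> (y \in s) = (k <= y < k + (size s).+1).
  by move=> neq_ya; have := sp y; rewrite inE (negPf neq_ya).
split; [lia | move=> y | split=> [y|/=]; last by lia].
  rewrite mem_filter szl; case: (ltnP y a) => /= ya; last by lia.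
  by rewrite memE ?neq_ltn ?ya //; lia.
rewrite mem_filter; case: (ltnP a y) => /= ya; last by lia.
by rewrite memE ?neq_ltn ?ya ?orbT //; lia.
Qed.

Lemma pos_sorted_uniq x : pos_sorted x -> uniq x.
Proof. by apply: pairwise_uniq => i; rewrite ltnn. Qed.

(** Leaf [l] sits between the labels [l - 1] and [l], so the labels from the leaf to vertex [j] are
    [l], ..., [j] on one side and [j], ..., [l - 1] on the other: hence one weak and one strict
    bound. The argument is that of [subtreeP] with this window. *)
Lemma vertex_leavesP m k x j (l : 'I_m) :
    pos_sorted x -> spans k x -> j \in x ->
  reflect (k <= l <= k + size x /\ forall y, y \in x ->
             (l <= y <= j) || (j <= y < l) -> pos j <= pos y)
    (l \in vertex_leaves m k (pruned x) j).
Proof.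
elim/pruned_ind: x k j => [|a s IHl IHr] k j; first by [].
move=> sorted_as; move: (sorted_as).
have uniq_as := pos_sorted_uniq sorted_as.
have lv := leaves_pruned uniq_as; move: lv; rewrite pruned_cons => lv.
move=> /= /andP[/allP min_a sorted_s].
have [uniq_l uniq_r] : uniq [seq b : 'I_n <- s | b < a] /\
  uniq [seq b : 'I_n <- s | a < b].
  by case/andP: uniq_as => _ uniq_s; rewrite !filter_uniq.
move=> /(spans_split uniq_as)[szl spl [spr szr]] jx.
have lvl : k + leaves (unprune (pruned [seq b : 'I_n <- s | b < a])) = a.+1.
  by rewrite leaves_pruned // addnS szl.
rewrite mem_labels_pruned mem_filter lvl.
have le_a y : y \in a :: s -> pos a <= pos y.
  by rewrite inE => /predU1P[-> //|/min_a/ltnW].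
have [eq_ja|neq_ja] := eqVneq j a.
  rewrite eq_ja inE lv /=.
  by apply: (iffP idP) => [lk|[lk _]]; [split=> [|y /le_a//] | ]; lia.
have js : j \in s by move: jx; rewrite inE (negPf neq_ja).
have lt_aj := min_a _ js; move: szr => /= szr.
have lta_s (y : 'I_n) : y \in a :: s -> y < a -> y \in s.
  by rewrite inE => /predU1P[->|//]; rewrite ltnn.
have gta_s (y : 'I_n) : y \in a :: s -> a < y -> y \in s.
  by rewrite inE => /predU1P[->|//]; rewrite ltnn.
(* As [a] precedes [j], the condition keeps [a] out of the window, which puts leaf [l] on the same
   side of [a] as [j]. *)
have a_l (H : forall y, y \in a :: s ->
    (l <= y <= j) || (j <= y < l) -> pos j <= pos y) :
    ~~ ((l <= a <= j) || (j <= a < l)).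
  by apply/negP=> /(H a (mem_head _ _)); rewrite leqNgt lt_aj.
rewrite js andbT; case: ifPn => ltja.
  apply: (iffP (IHl _ _ (pos_sorted_filter _ sorted_s) spl _)).
  - by rewrite mem_filter ltja.
  - rewrite szl => -[lk H]; split=> [|y ys yl]; first by lia.
    have ya : y < a by lia.
    by apply: H => //; rewrite mem_filter ya lta_s.
  - move=> [lk H]; split=> [|y]; first by move/a_l: (H); rewrite szl; lia.
    by rewrite mem_filter => /andP[_ ys]; apply: H; rewrite inE ys orbT.
have ltaj : a < j by move: neq_ja; rewrite -val_eqE /=; lia.
apply: (iffP (IHr _ _ (pos_sorted_filter _ sorted_s) spr _)).
- by rewrite mem_filter ltaj.
- rewrite szr => -[lk H]; split=> [|y ys yl]; first by lia.
  have ya : a < y by lia.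
  by apply: H => //; rewrite mem_filter ya gta_s.
- move=> [lk H]; split=> [|y]; first by move/a_l: (H); rewrite szr; lia.
  by rewrite mem_filter => /andP[_ ys]; apply: H; rewrite inE ys orbT.
Qed.

(** Subtrees rooted at vertices have at least two leaves, those rooted at leaves have one, and the
    bound on [k + size x] keeps leaf ranges from being cut off by ['I_m]. So the cardinality test
    retains exactly the vertices. *)
Lemma clades_prunedP m k x (A : {set 'I_m}) :
    uniq x -> spans k x -> k + size x < m ->
  reflect (exists2 j, j \in x & A = vertex_leaves m k (pruned x) j)
    ((A \in clades m k (unprune (pruned x))) && (#|A| != 1)).
Proof.
elim/pruned_ind: x k => [|a s IHl IHr] k.
  rewrite addn0 => _ _ ltkm; rewrite inE; apply: (iffP idP) => [|[]//].
  by case/andP=> /eqP->; rewrite card_leaf_range //= addn1.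
move=> uniq_as sp; have [_ uniq_s] := andP uniq_as.
have lv := leaves_pruned uniq_as; move: lv; rewrite pruned_cons => lv.
have [uniq_l uniq_r] : uniq [seq b : 'I_n <- s | b < a] /\
  uniq [seq b : 'I_n <- s | a < b] by rewrite !filter_uniq.
have [szl spl [spr szr]] := spans_split uniq_as sp.
move=> ltkm; have ltam : a < m.
  by have := sp a; rewrite mem_head /= in ltkm *; lia.
have {}IHl := IHl k uniq_l spl ltac:(lia).
have {}IHr := IHr a.+1 uniq_r spr ltac:(lia).
have neqC (j : 'I_n) : j != a -> (j \in s) && ~~ (j < a) = (a < j) && (j \in s).
  by rewrite -val_eqE /=; case: ltngtP; rewrite ?andbF ?andbT.
rewrite /= inE mem_cat leaves_pruned // addnS szl.
rewrite !andb_orl; apply: (iffP or3P).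
  case=> [/andP[/eqP-> _]|/IHl[j]|/IHr[j]].
  - by exists a; rewrite ?mem_head ?eqxx.
  - rewrite mem_filter => /andP[ltja js] ->; exists j.
      by rewrite inE js orbT.
    rewrite mem_labels_pruned mem_filter ltja js /=.
    by rewrite [j == a]ltn_eqF.
  - rewrite mem_filter => /andP[ltaj js] ->; exists j.
      by rewrite inE js orbT.
    rewrite mem_labels_pruned mem_filter [j < a]ltnNge ltnW //=.
    by rewrite [j == a]gtn_eqF.
case=> j; rewrite inE; have [->|neq_ja] /= := eqVneq j a => [_ defA|js].
  apply: Or31; rewrite defA eqxx card_leaf_range lv //=.
  by move: ltkm => /=; lia.
rewrite mem_labels_pruned mem_filter js andbT; case: ltnP => ja defA.
  by apply/Or32/IHl; exists j; rewrite ?mem_filter ?ja.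
apply/Or33/IHr; exists j => //; rewrite mem_filter js andbT ltn_neqAle ja.
by rewrite eq_sym val_eqE neq_ja.
Qed.

End PrunedTree.

(** * Trees of permutations, read off from positions *)

Local Notation pos w i := (nat_of_ord (w^-1%g i)).

Section PermTree.
Variable n : nat.
Implicit Types (u v w : {perm 'I_n}) (i j k l y : 'I_n).

Lemma pos_inj w i j : pos w i = pos w j -> i = j.
Proof. by move/val_inj/perm_inj. Qed.

Lemma ltn_pos w i j : (pos w i < pos w j) = (i != j) && (pos w i <= pos w j).
Proof. by rewrite ltn_neqAle val_eqE (inj_eq perm_inj). Qed.

Lemma mem_inversions w i j :
  ((j, i) \in inversions w) = (i < j) && (pos w j < pos w i).
Proof. by rewrite inE. Qed.

Lemma pos_sorted_one_line w : pos_sorted (fun i => pos w i) (one_line w).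
Proof.
rewrite /pos_sorted pairwise_map.
have: pairwise ltn (map val (enum 'I_n)).
  by rewrite val_enum_ord -(sorted_pairwise ltn_trans) iota_ltn_sorted.
rewrite pairwise_map; apply: sub_pairwise => i j /=.
by rewrite !permK.
Qed.

Lemma mem_one_line w i : i \in one_line w.
Proof. by rewrite -[i](permKV w) map_f // mem_enum. Qed.

Lemma size_one_line w : size (one_line w) = n.
Proof. by rewrite size_map size_enum_ord. Qed.

Lemma spans_one_line w : spans 0 (one_line w).
Proof. by move=> i; rewrite mem_one_line size_one_line ltn_ord. Qed.

Lemma P_leP w k j :
  reflect (forall y, (k <= y <= j) || (j <= y <= k) -> pos w j <= pos w y)
    (P_le w k j).
Proof.
apply: (iffP (subtreeP k (pos_sorted_one_line w) (mem_one_line w j))).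
  by case=> _ H y; apply: H; apply: mem_one_line.
by move=> H; split=> [|y _]; [apply: mem_one_line | apply: H].
Qed.

Lemma in_leftE w i j : in_left w i j = (j < i) && P_le w j i.
Proof. exact: mem_left_subtree (pos_sorted_one_line w) (mem_one_line w i). Qed.

Lemma namedP w j (l : 'I_n.+1) :
  reflect (forall y, (l <= y <= j) || (j <= y < l) -> pos w j <= pos w y)
    (l \in named w j).
Proof.
apply: (iffP (vertex_leavesP l (pos_sorted_one_line w) (@spans_one_line w)
                (mem_one_line w j))).
  by case=> _ H y; apply: H; apply: mem_one_line.
move=> H; split=> [|y _]; last exact: H.
by rewrite size_one_line add0n leq0n -ltnS ltn_ord.
Qed.

Lemma in_left_inversion w i j : in_left w i j -> (i, j) \in inversions w.
Proof.
rewrite in_leftE => /andP[ltji /P_leP le_ij].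
rewrite mem_inversions ltji ltn_pos le_ij ?leqnn ?(ltnW ltji) //.
by rewrite -val_eqE gtn_eqF.
Qed.

(** Take the least [i'] inverted with [j]. A value strictly between [j] and [i'] is not inverted
    with [j], so it comes after [j] and therefore after [i']; thus [j] lies in the subtree at
    [i']. *)
Lemma inversion_in_left w i j : (i, j) \in inversions w ->
  exists2 i', in_left w i' j & i' <= i.
Proof.
move=> inv_ij.
have [i' inv_i' min_i'] :=
  arg_minnP (P := fun i => (i, j) \in inversions w) val inv_ij.
exists i'; last exact: min_i'.
rewrite in_leftE; move: inv_i'; rewrite mem_inversions => /andP[ltji lt_pos].
rewrite ltji; apply/P_leP=> y yij; have [->//|neq_yi] := eqVneq y i'.
have : ~~ ((y, j) \in inversions w).
  by apply/negP => /min_i' /=; move: neq_yi; rewrite -val_eqE /=; lia.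
have [->|neq_yj] := eqVneq y j; first by lia.
by rewrite mem_inversions; move: neq_yj; rewrite -val_eqE /=; lia.
Qed.

Lemma P_labP w j :
  reflect (exists i, (i, j) \in inversions w) (j \in P_lab w).
Proof.
rewrite inE; apply: (iffP existsP) => -[i].
  by exists i; apply: in_left_inversion.
by case/inversion_in_left=> i'; exists i'.
Qed.

(** [arg_minnP] wants a default that satisfies the predicate, and the default [j] of [fdual] never
    does: [j] is not in its own left subtree. *)
Lemma arg_min_default (T : finType) (P : pred T) (F : T -> nat) x0 x1 :
  P x1 -> [arg min_(x < x0 | P x) F x] = [arg min_(x < x1 | P x) F x].
Proof.
move=> Px1.
have [x Px min_x] : exists2 x, P x & forall z, P z -> F x <= F z.
  by have [x] := arg_minnP F Px1; exists x.
rewrite /arg_min /extremum; case: pickP => //= /(_ x).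
by rewrite /= Px => /forallP[] y; apply/implyP/min_x.
Qed.

Lemma fdualP w j : j \in P_lab w ->
  fdual w j \in inversions w /\
  forall i, (i, j) \in inversions w -> (fdual w j).1 <= i.
Proof.
rewrite inE /fdual => /existsP[i0 left_i0].
rewrite (arg_min_default (P := fun i => in_left w i j) _ _ left_i0).
case: (arg_minnP (P := fun i => in_left w i j)) => // i left_i min_i.
split=> [|i1]; first exact: in_left_inversion.
by case/inversion_in_left=> i' /min_i; apply: leq_trans.
Qed.

(** Let [k] be in the subtree at [j] and [f(j) = (i, j)]. Then [i] precedes [j], which weakly
    precedes [k], and [i > k], as otherwise [i] would lie between [j] and [k] while preceding [j].
    So [(i, k)] is an inversion, and the first coordinate of [f(k)] is at most [i]. *)
Lemma fdual_order_preserving w :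
  order_preserving (mem (P_lab w)) (P_le w)
    (mem (inversions w)) (inversion_le w) (fdual w).
Proof.
split=> [j /fdualP[]//|k j].
move=> /[dup] Pk /fdualP[_ min_k] /fdualP[+ _] /P_leP le_kj.
have le_pos : pos w j <= pos w k by apply: le_kj; lia.
rewrite /inversion_le le_pos andbT /fdual /= mem_inversions.
move=> /andP[ltj lt_pos].
apply: min_k; rewrite mem_inversions; set i := arg_min _ _ _ in ltj lt_pos *.
have := le_kj i; lia.
Qed.

(** The window of the last leaf consists of all labels from [j] on, so the leaf belongs to the
    subtree iff no larger label precedes [j]. This matches the exclusion of the last leaf in [RP]
    with that of the right arm. *)
Lemma ord_max_named w j : (ord_max \in named w j) = (j \notin P_lab w).
Proof.
apply/namedP/idP => [H|/P_labP H y /=].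
  apply/P_labP=> -[i]; rewrite mem_inversions => /andP[ltji].
  by rewrite ltnNge H //= ltn_ord (ltnW ltji) orbT.
have [->//|neq_jy] := eqVneq j y.
move=> yj; rewrite leqNgt; apply/negP=> lt_pos; case: H; exists y.
rewrite mem_inversions lt_pos andbT ltn_neqAle val_eqE neq_jy.
by have := ltn_ord j; lia.
Qed.

Lemma mem_reduced w (A : {set 'I_n.+1}) :
  reflect (exists2 j, j \in P_lab w & A = named w j)
    (A \in reduced (ptmap w)).
Proof.
have cladesP (B : {set 'I_n.+1}) :
    reflect (exists2 j, j \in one_line w & B = named w j)
      ((B \in clades n.+1 0 (ptmap w)) && (#|B| != 1)).
  apply: clades_prunedP (pos_sorted_uniq (pos_sorted_one_line w)) _ _.
    exact: spans_one_line.
  by rewrite size_one_line.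
rewrite !inE andbAC; apply: (iffP andP) => [[/cladesP[j _ ->]]|[j Pj ->]].
  by rewrite ord_max_named negbK; exists j.
rewrite ord_max_named Pj; split=> //.
by apply/cladesP; exists j; first exact: mem_one_line.
Qed.

(** Vertex [k] lies between the leaves [k] and [k + 1], both in its own leaf set. The one farther
    from [j] has as its window exactly the labels between [k] and [j], so its membership in the
    larger set gives [P_leP]. *)
Lemma named_subset w j k : (named w k \subset named w j) = P_le w k j.
Proof.
apply/subsetP/P_leP=> [sub_kj|le_kj l /namedP lk].
  case: (leqP k j) => [lekj|ltjk] y yij.
    have /sub_kj/namedP : widen_ord (leqnSn n) k \in named w k.
      by apply/namedP=> x /= xk; have -> : x = k by apply: ord_inj; lia.
    by apply=> /=; lia.
  have /sub_kj/namedP : lift ord0 k \in named w k.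
    apply/namedP=> x; rewrite lift0 => xk.
    by have -> : x = k by apply: ord_inj; lia.
  by apply; rewrite lift0; lia.
have le_pos : pos w j <= pos w k by apply: le_kj; lia.
apply/namedP=> y yl; case: (boolP ((k <= y <= j) || (j <= y <= k))) => [|yk].
  exact: le_kj.
by apply: leq_trans le_pos _; apply: lk; lia.
Qed.

Lemma P_le_anti w j k : P_le w k j -> P_le w j k -> j = k.
Proof.
move=> /P_leP le_kj /P_leP le_jk; apply: (@pos_inj w).
by have := le_kj k; have := le_jk j; lia.
Qed.

Lemma named_inj w : injective (named w).
Proof.
by move=> j k eq_jk; apply: (@P_le_anti w); rewrite -named_subset eq_jk.
Qed.

Lemma named_order_iso w :
  order_iso (mem (P_lab w)) (P_le w)
    (mem (reduced (ptmap w))) (@inclusion _) (named w).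
Proof.
split=> [j Pj|j k _ _|A /mem_reduced[j Pj ->]|k j _ _].
- by apply/mem_reduced; exists j.
- exact: named_inj.
- by exists j.
- exact: named_subset.
Qed.

End PermTree.

(** * Edelman's poset as ideals of inversion posets *)

Section Edelman.
Variable n : nat.
Implicit Types (u v w : {perm 'I_n}) (i j k l y : 'I_n).
Implicit Type D : {set 'I_n * 'I_n}.

Lemma inversion_idealP w D :
  reflect (D \subset inversions w /\
     forall i j k l, (k, l) \in D -> (j, i) \in inversions w ->
       j <= k -> pos w l <= pos w i -> (j, i) \in D)
    (D \in J (inversions w) (inversion_le w)).
Proof.
apply: (iffP (idealP _ _ _)) => -[sub_D ideal_D]; split=> //.
  by move=> i j k l Dkl Iji lejk le_pos; apply: ideal_D Dkl Iji _; apply/andP.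
by move=> [k l] [j i] Dkl Iji /andP[/=]; apply: ideal_D Dkl Iji.
Qed.

Lemma pos_inversions v j i : i < j ->
  (pos v j < pos v i) = ((j, i) \in inversions v).
Proof. by rewrite mem_inversions => ->. Qed.

(** Inversions decide which of two values comes first, and the position of a value is the number of
    values before it. *)
Lemma inversions_inj : injective (@inversions n).
Proof.
move=> v w eq_vw.
have lt_pos i j : (pos v i < pos v j) = (pos w i < pos w j).
  have [ltji|ltij|/ord_inj->] := ltngtP j i; last by rewrite !ltnn.
    by rewrite !pos_inversions ?eq_vw.
  have neq_pos u : (pos u i < pos u j) = ~~ (pos u j < pos u i).
    by rewrite -leqNgt ltn_pos -val_eqE ltn_eqF.
  by rewrite !neq_pos !pos_inversions ?eq_vw.
apply: invg_inj; apply/permP=> i; apply: ord_inj.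
have rank u : #|[set j | pos u j < pos u i]| = pos u i.
  rewrite -(card_imset _ (@perm_inj _ u^-1%g)).
  have -> : [set u^-1%g j | j in [set j | pos u j < pos u i]] =
            [set j : 'I_n | j < pos u i].
    apply/setP=> j; rewrite inE; apply/imsetP/idP => [[k]|ltj].
      by rewrite inE => ? ->.
    by exists (u j); rewrite ?inE permK.
  rewrite cardE -(size_map val) -[RHS](size_iota 0); apply: perm_size.
  apply: uniq_perm; rewrite ?iota_uniq ?(map_inj_uniq val_inj) ?enum_uniq //.
  move=> k; rewrite mem_iota; apply/mapP/idP => [[j]|/= ltk].
    by rewrite mem_enum inE => ? ->.
  have ltkn := ltn_trans ltk (ltn_ord _).
  by exists (Ordinal ltkn); rewrite // mem_enum inE.
rewrite -(rank v) -(rank w); congr #|pred_of_set _|.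
by apply/setP=> j; rewrite !inE.
Qed.

Lemma val_tperm (p q x : 'I_n) :
  tperm p q x =
    (if x == p :> nat then q : nat else if x == q :> nat then p : nat else x)
  :> nat.
Proof.
rewrite !val_eqE; have [->|neq_p] := eqVneq x p; first by rewrite tpermL.
by have [->|neq_q] := eqVneq x q; [rewrite tpermR | rewrite tpermD // eq_sym].
Qed.

(** The positions are adjacent, so every third value is on the same side of both entries and only
    their mutual order changes. *)
Lemma inversions_tperm u (p q : 'I_n) : q = p.+1 :> nat -> u p < u q ->
  inversions (tperm p q * u)%g = (u q, u p) |: inversions u.
Proof.
move=> adj lt_u; apply/setP=> -[j i].
rewrite in_setU1 !mem_inversions xpair_eqE !invMg !permM !tpermV !val_tperm.
have eq_pos (k r : 'I_n) : (k == u r) = (pos u k == r).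
  by rewrite val_eqE; apply/eqP/eqP=> [->|<-]; rewrite ?permK ?permKV.
have posE (k r : 'I_n) : pos u k = r -> k = u r.
  by move/eqP; rewrite -eq_pos => /eqP.
have lt_i : pos u j = p -> pos u i = q -> j < i by move=> /posE-> /posE->.
have lt_j : pos u j = q -> pos u i = p -> i < j by move=> /posE-> /posE->.
rewrite !eq_pos; clear -adj lt_i lt_j.
by move: (pos u j) (pos u i) lt_i lt_j => x y; do 4?[case: ifP]; lia.
Qed.

(** It must be shown that [l] weakly before [i] in [w] implies the same in [v]. If [i < l], then
    [(l, i)] is an inversion of [w] below [(k, l)], hence one of [v]; if [l < i] and [i] came first
    in [v], then [(i, l)] would be an inversion of [v] and so of [w]. *)
Lemma inversion_ideal_trans D v w :
  D \in J (inversions v) (inversion_le v) ->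
  inversions v \in J (inversions w) (inversion_le w) ->
  D \in J (inversions w) (inversion_le w).
Proof.
move=> /inversion_idealP[sub_Dv ideal_D] /inversion_idealP[sub_vw ideal_v].
apply/inversion_idealP; split=> [|i j k l Dkl Iji lejk le_pos].
  exact: subset_trans sub_vw.
have Ikl := subsetP sub_Dv _ Dkl.
have Iji_v := ideal_v _ _ _ _ Ikl Iji lejk le_pos.
apply: (ideal_D _ _ _ _ Dkl Iji_v lejk); rewrite leqNgt; apply/negP=> lt_pos.
have [ltil|ltli|/ord_inj eq_il] := ltngtP i l;
  last by rewrite eq_il ltnn in lt_pos.
  have : (l, i) \in inversions v.
    apply: (ideal_v _ _ _ _ Ikl _ _ le_pos); last first.
      by move: Ikl; rewrite mem_inversions => /andP[/ltnW].
    rewrite mem_inversions ltil ltn_pos le_pos andbT.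
    by rewrite -val_eqE gtn_eqF.
  by rewrite mem_inversions; lia.
have : (i, l) \in inversions w.
  by apply: (subsetP sub_vw); rewrite mem_inversions ltli.
by rewrite mem_inversions; lia.
Qed.

(** Here the comparison passes from [v] to [w]. If [i < l], the inversion [(l, i)] of [v] is one of
    [w]; if [l < i] and [i] came first in [w], then [(i, l)] would lie below [(k, l)], hence in [D]
    and in the inversions of [v]. *)
Lemma inversion_ideal_restrict D v w :
  D \in J (inversions w) (inversion_le w) ->
  D \subset inversions v -> inversions v \subset inversions w ->
  D \in J (inversions v) (inversion_le v).
Proof.
move=> /inversion_idealP[sub_Dw ideal_D] sub_Dv sub_vw.
apply/inversion_idealP; split=> // i j k l Dkl Iji lejk le_pos.
apply: (ideal_D _ _ _ _ Dkl (subsetP sub_vw _ Iji) lejk); rewrite leqNgt.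
apply/negP=> lt_pos.
have [ltil|ltli|/ord_inj eq_il] := ltngtP i l;
  last by rewrite eq_il ltnn in lt_pos.
  have : (l, i) \in inversions w.
    apply: (subsetP sub_vw).
    by rewrite mem_inversions ltil ltn_pos le_pos andbT -val_eqE gtn_eqF.
  by rewrite mem_inversions; lia.
have : (i, l) \in inversions v.
  apply: (subsetP sub_Dv); apply: (ideal_D _ _ _ _ Dkl _ _ (leqnn _)).
    by rewrite mem_inversions ltli.
  move: Iji; rewrite mem_inversions => /andP[/ltnW leij _].
  exact: leq_trans lejk.
by rewrite mem_inversions; lia.
Qed.

(** The added inversion [(u q, u p)] is maximal for [w]: in a larger one [(k, l)], [k] stands at
    position [p] or before, where the covering condition allows nothing above [u q]. So [k = u q],
    and [l] is the next entry [u p]. *)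
Lemma edelman_cover_ideal u w : edelman_cover u w ->
  inversions u \in J (inversions w) (inversion_le w).
Proof.
case/existsP=> p /existsP[q /and4P[/eqP adj lt_u /eqP def_w /forallP left_p]].
have inv_w : inversions w = (u q, u p) |: inversions u.
  by rewrite def_w inversions_tperm.
have wp : w p = u q by rewrite def_w permM tpermL.
have wq : w q = u p by rewrite def_w permM tpermR.
apply/inversion_idealP; rewrite inv_w; split=> [|i j k l].
  exact: subsetUr.
move=> Ikl; rewrite in_setU1 xpair_eqE => /orP[/andP[/eqP-> /eqP->]|//].
move=> lek le_pos.
have Ikl_w : (k, l) \in inversions w by rewrite inv_w in_setU1 Ikl orbT.
have pos_up : pos w (u p) = p.+1 by rewrite -wq permK.
move: le_pos Ikl_w; rewrite pos_up mem_inversions => le_pos /andP[_ lt_pos].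
have lekp : pos w k <= p by lia.
have [ltkp|gtkp|/ord_inj eq_kp] := ltngtP (pos w k) p; first 2 last.
- have eq_k : k = u q by rewrite -wp -eq_kp permKV.
  have eq_l : l = u p.
    rewrite -wq; apply: (canRL (permKV w)); apply: ord_inj.
    by rewrite adj; move: lt_pos; rewrite eq_kp; lia.
  by rewrite -eq_k -eq_l.
- have := left_p (w^-1%g k); rewrite ltkp permKV -leqNgt => lek'.
  have /ord_inj eq_k : k = u q :> nat by lia.
  by move: ltkp; rewrite eq_k -wp permK ltnn.
- by lia.
Qed.

Lemma edelman_le_ideal u w : edelman_le u w ->
  inversions u \in J (inversions w) (inversion_le w).
Proof.
case/connectP=> s; elim: s u => [|v s IH] u /=.
  by move=> _ ->; apply/inversion_idealP.
case/andP=> /edelman_cover_ideal ideal_u path_s last_s.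
by apply: inversion_ideal_trans ideal_u _; apply: IH.
Qed.

(** A maximal element of [I(w)] is an adjacent descent of [w] whose first entry
    is a left-to-right maximum, so that undoing it is a step down in Edelman's
    poset. *)
Lemma edelman_cover_max w a b :
  (b, a) \in inversions w ->
  (forall x c, (c, x) \in inversions w -> b <= c -> pos w x <= pos w a ->
     (c, x) = (b, a)) ->
  exists2 v, edelman_cover v w &
    inversions w = (b, a) |: inversions v /\ (b, a) \notin inversions v.
Proof.
move=> inv_ba max_ba; move: (inv_ba).
rewrite mem_inversions => /andP[ltab lt_pos].
set p := (w^-1)%g b in lt_pos; set q := (w^-1)%g a in lt_pos max_ba.
have wp : w p = b by rewrite permKV.
have wq : w q = a by rewrite permKV.
have no_gt (c : 'I_n) : b < c -> p <= pos w c.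
  move=> ltbc; rewrite leqNgt; apply/negP=> ltcp.
  have [eq_c] : (c, a) = (b, a).
    apply: max_ba (ltnW ltbc) (leqnn _).
    by rewrite mem_inversions (ltn_trans ltab ltbc) (ltn_trans ltcp).
  by rewrite eq_c ltnn in ltbc.
have adj : q = p.+1 :> nat.
  apply/eqP; rewrite eqn_leq lt_pos andbT leqNgt; apply/negP=> lt_pq.
  (* An entry strictly between the two would give an inversion above [(b, a)]: it replaces [a] if it
     is below [b], and replaces [b] if it is above. *)
  pose r := Ordinal (ltn_trans lt_pq (ltn_ord q)).
  have pos_x : pos w (w r) = p.+1 by rewrite permK.
  have [ltxb|ltbx|/ord_inj eq_x] := ltngtP (w r) b.
  - have [eq_x] : (b, w r) = (b, a).
      apply: max_ba; rewrite ?mem_inversions ?pos_x //.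
      by rewrite ltxb ltnSn.
    by move: pos_x; rewrite eq_x -/q; lia.
  - have [eq_x] : (w r, a) = (b, a).
      apply: max_ba (ltnW ltbx) (leqnn _).
      by rewrite mem_inversions pos_x (ltn_trans ltab ltbx).
    by rewrite eq_x ltnn in ltbx.
  - by move: pos_x; rewrite eq_x -/p; lia.
pose v := (tperm p q * w)%g.
have vp : v p = a by rewrite permM tpermL.
have vq : v q = b by rewrite permM tpermR.
have def_w : w = (tperm p q * v)%g by rewrite mulgA tperm2 mul1g.
exists v; last first.
  split; first by rewrite {1}def_w inversions_tperm ?vp ?vq.
  by rewrite mem_inversions -vp -vq !permK; lia.
apply/existsP; exists p; apply/existsP; exists q.
rewrite adj eqxx vp vq ltab -def_w eqxx.
apply/forallP=> i; apply/implyP=> ltip; apply/negP=> /no_gt.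
by rewrite permK leqNgt ltip.
Qed.

(** Induction on the number of inversions outside [D]. One that is maximal among them is maximal
    among all inversions, since [D] is closed downwards; undoing it is a step down that keeps [D] an
    ideal. *)
Lemma ideal_inversions w D : D \in J (inversions w) (inversion_le w) ->
  exists2 v, edelman_le v w & inversions v = D.
Proof.
have [m] := ubnP #|inversions w :\: D|; elim: m w => // m IH w lt_m ideal_D.
have [sub_Dw closed_D] := inversion_idealP _ _ ideal_D.
have [/eqP|[[b0 a0] Iba0]] := set_0Vmem (inversions w :\: D).
  rewrite setD_eq0 => sub_wD; exists w; first exact: connect0.
  by apply/eqP; rewrite eqEsubset sub_wD.
(* A maximal inversion outside [D] is found lexicographically: largest first coordinate, then
   earliest second entry in [w]. *)
have [[b1 a1] Iba1 max_b] := arg_maxnP (P := mem (inversions w :\: D))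
  (fun x : 'I_n * 'I_n => nat_of_ord x.1) Iba0.
have Pa1 : (b1, a1) \in inversions w :\: D by [].
have [a Pa min_a] := arg_minnP (P := fun a => (b1, a) \in inversions w :\: D)
  (fun a => pos w a) Pa1.
move: b1 => b in max_b Pa1 Pa min_a Iba1 *.
have [nDba Iba] : (b, a) \notin D /\ (b, a) \in inversions w.
  by move: Pa; rewrite in_setD => /andP[].
have max_ba x c : (c, x) \in inversions w -> b <= c -> pos w x <= pos w a ->
    (c, x) = (b, a).
  move=> Icx lebc le_pos.
  have Pcx : (c, x) \in inversions w :\: D.
    rewrite in_setD Icx andbT; apply: contra nDba => Dcx.
    exact: closed_D Dcx Iba lebc le_pos.
  have eq_c : c = b by apply: ord_inj; have /= := max_b _ Pcx; lia.
  rewrite eq_c in Pcx *; congr (_, _); apply: (@pos_inj _ w).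
  by have /= := min_a _ Pcx; lia.
have [v cov_v [inv_w nIba]] := edelman_cover_max Iba max_ba.
have [||u le_uv inv_u] := IH v; last first.
- by exists u => //; apply: connect_trans le_uv (connect1 cov_v).
- apply: inversion_ideal_restrict ideal_D _ _; last by rewrite inv_w subsetUr.
  apply/subsetP=> x Dx; have := subsetP sub_Dw _ Dx; rewrite inv_w in_setU1.
  by case/predU1P=> // eq_x; rewrite -eq_x Dx in nDba.
- rewrite -ltnS; apply: leq_trans lt_m; rewrite ltnS; apply: proper_card.
  rewrite properE inv_w setSD ?subsetUr //=; apply/subsetPn; exists (b, a).
    by rewrite in_setD nDba setU11.
  by rewrite in_setD (negPf nIba) andbF.
Qed.

Lemma edelman_leE v w :
  edelman_le v w = (inversions v \in J (inversions w) (inversion_le w)).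
Proof.
apply/idP/idP=> [|/ideal_inversions[u le_uw /inversions_inj <-//]].
exact: edelman_le_ideal.
Qed.

Lemma edelman_le_inversions u v w : edelman_le u w -> edelman_le v w ->
  (inversions u \subset inversions v) = edelman_le u v.
Proof.
rewrite !edelman_leE => ideal_u /inversion_idealP[sub_vw _].
apply/idP/idP=> [sub_uv|/inversion_idealP[]//].
exact: inversion_ideal_restrict ideal_u sub_uv sub_vw.
Qed.

Lemma edelman_order_iso w :
  order_iso [pred v | edelman_le v w] (@edelman_le n)
    (mem (J (inversions w) (inversion_le w))) (@inclusion _) (@inversions n).
Proof.
split=> [v|u v _ _|D|u v].
- exact: edelman_le_ideal.
- exact: inversions_inj.
- by case/ideal_inversions=> v; exists v.
- exact: edelman_le_inversions.
Qed.

End Edelman.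

(** * Leaf sets of the subtrees of a full binary tree *)

Section Clades.
Variable m : nat.
Implicit Types (s t l r : bintree) (A B : {set 'I_m}).

Lemma clades_Node k l r A : (A \in clades m k (Node l r)) =
  [|| A == leaf_range m k (Node l r), A \in clades m k l
    | A \in clades m (k + leaves l) r].
Proof. by rewrite /= inE mem_cat. Qed.

Lemma clade_sub k t A : A \in clades m k t -> A \subset leaf_range m k t.
Proof.
elim: t k => [|l IHl r IHr] k /=; first by rewrite inE => /eqP->.
rewrite inE mem_cat => /or3P[/eqP->//|/IHl|/IHr] /subset_trans; apply;
  by apply/subsetP=> i; rewrite !inE /=; lia.
Qed.

Lemma clade_neq0 k t A : k + leaves t <= m -> A \in clades m k t ->
  exists i, i \in A.
Proof.
have leaf s j : j + leaves s <= m -> exists i, i \in leaf_range m j s.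
  move=> le_m; have lt_jm : j < m by have := leaves_gt0 s; lia.
  by exists (Ordinal lt_jm); rewrite inE /=; have := leaves_gt0 s; lia.
elim: t k => [|l IHl r IHr] k le_m /=.
  by rewrite inE => /eqP->; apply: leaf.
rewrite inE mem_cat => /or3P[/eqP->|/IHl|/IHr]; first exact: leaf.
- by apply; move: le_m => /=; lia.
- by apply; move: le_m => /=; lia.
Qed.

Lemma clades_set1 k t (i : 'I_m) :
  k <= i < k + leaves t -> [set i] \in clades m k t.
Proof.
elim: t k => [|l IHl r IHr] k ik /=.
  by rewrite inE; apply/eqP/setP=> j; rewrite !inE -val_eqE /= in ik *; lia.
rewrite inE mem_cat; case: (ltnP i (k + leaves l)) => il.
  by rewrite IHl ?orbT //; lia.
by rewrite IHr ?orbT //; move: ik => /=; lia.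
Qed.

Lemma clade_left k l r A : k + leaves (Node l r) <= m ->
  A \in clades m k (Node l r) -> A \subset leaf_range m k l ->
  A \in clades m k l.
Proof.
move=> le_m clade_A sub_A; have [i Ai] := clade_neq0 le_m clade_A.
have := subsetP sub_A _ Ai; rewrite inE => il.
move: clade_A; rewrite clades_Node => /or3P[/eqP eq_A|//|/clade_sub/subsetP].
  have := subset_leq_card sub_A; rewrite eq_A !card_leaf_range //=; last first.
    by move: le_m => /=; lia.
  by have := leaves_gt0 r; lia.
by move/(_ _ Ai); rewrite inE; lia.
Qed.

Lemma clade_right k l r A : k + leaves (Node l r) <= m ->
  A \in clades m k (Node l r) -> A \subset leaf_range m (k + leaves l) r ->
  A \in clades m (k + leaves l) r.
Proof.
move=> le_m clade_A sub_A; have [i Ai] := clade_neq0 le_m clade_A.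
have := subsetP sub_A _ Ai; rewrite inE => ir.
move: clade_A; rewrite clades_Node => /or3P[/eqP eq_A|/clade_sub/subsetP|//].
  have := subset_leq_card sub_A; rewrite eq_A !card_leaf_range //=; last first.
    by move: le_m => /=; lia.
  by have := leaves_gt0 l; lia.
by move/(_ _ Ai); rewrite inE; lia.
Qed.

(** Localizes a tree at one of its leaf sets, so that two trees sharing that set can be compared
    there. *)
Lemma clade_subtree k t A : k + leaves t <= m -> A \in clades m k t ->
  exists k' t', [/\ k' + leaves t' <= m, A = leaf_range m k' t' &
    forall B, (B \in clades m k' t') = (B \in clades m k t) && (B \subset A)].
Proof.
elim: t k => [|l IHl r IHr] k le_m.
  rewrite inE => /eqP->; exists k, Leaf; split=> // B.
  by apply/esym/andb_idr; apply: clade_sub.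
have [le_l le_r] : k + leaves l <= m /\ (k + leaves l) + leaves r <= m.
  by move: le_m => /=; lia.
rewrite (clades_Node k l r A) => /or3P[/eqP->|cl_A|cr_A].
- exists k, (Node l r); split=> // B.
  by apply/esym/andb_idr; apply: clade_sub.
- have [k' [t' [le_m' eq_A mem_t']]] := IHl _ le_l cl_A.
  exists k', t'; split=> // B; rewrite mem_t' andbC [RHS]andbC.
  apply: andb_id2l => sub_B; apply/idP/idP=> cl_B.
    by rewrite clades_Node cl_B orbT.
  exact: clade_left le_m cl_B (subset_trans sub_B (clade_sub cl_A)).
- have [k' [t' [le_m' eq_A mem_t']]] := IHr _ le_r cr_A.
  exists k', t'; split=> // B; rewrite mem_t' andbC [RHS]andbC.
  apply: andb_id2l => sub_B; apply/idP/idP=> cl_B.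
    by rewrite clades_Node cl_B !orbT.
  exact: clade_right le_m cl_B (subset_trans sub_B (clade_sub cr_A)).
Qed.

Lemma leaf_range_sub k t k' t' : k + leaves t <= m ->
  leaf_range m k t \subset leaf_range m k' t' ->
  k' <= k /\ k + leaves t <= k' + leaves t'.
Proof.
move=> le_m /subsetP sub; have t_gt0 := leaves_gt0 t.
have lt_first : k < m by lia.
have lt_last : k + (leaves t).-1 < m by lia.
have := sub (Ordinal lt_first); have := sub (Ordinal lt_last).
by rewrite !inE /= => /(_ ltac:(lia)) + /(_ ltac:(lia)); lia.
Qed.

(** Apart from the whole tree, the leaf sets that begin at the first leaf all come from the left
    child, because those of the right child begin later. *)
Lemma clade_left_child k l l' r' :
    leaves l < leaves (Node l' r') -> k + leaves (Node l' r') <= m ->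
  leaf_range m k l \in clades m k (Node l' r') -> leaves l <= leaves l'.
Proof.
move=> lt_l le_m; rewrite /= inE mem_cat.
have le_lm : k + leaves l <= m by lia.
case/or3P=> [/eqP/esym eq_l|/clade_sub/(leaf_range_sub le_lm)|
              /clade_sub/(leaf_range_sub le_lm)].
- have := leaf_range_sub (t := Node l' r') le_m; move=> /(_ k l).
  by rewrite [leaf_range _ _ _]eq_l subxx => /(_ isT); lia.
- by lia.
- by have := leaves_gt0 l'; lia.
Qed.

Lemma clade_right_child k k' r l' r' :
    k < k' -> k' + leaves r = k + leaves (Node l' r') ->
    k + leaves (Node l' r') <= m ->
  leaf_range m k' r \in clades m k (Node l' r') -> k + leaves l' <= k'.
Proof.
move=> lt_k eq_r le_m; rewrite /= inE mem_cat.
have le_rm : k' + leaves r <= m by lia.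
case/or3P=> [/eqP/esym eq_l|/clade_sub/(leaf_range_sub le_rm)|
              /clade_sub/(leaf_range_sub le_rm)].
- have := leaf_range_sub (t := Node l' r') le_m; move=> /(_ k' r).
  by rewrite [leaf_range _ _ _]eq_l subxx => /(_ isT); lia.
- by have := leaves_gt0 r'; move: eq_r => /=; lia.
- by lia.
Qed.

(** A family of leaf sets is maximal. The left child of [s] gives a proper leaf set of [t] at the
    first leaf, so it is no larger than the left child of [t]; the right child gives the opposite
    bound. The split is therefore the same, and induction applies to both children. *)
Lemma clades_sub_eq k s t : leaves s = leaves t -> k + leaves s <= m ->
  {subset clades m k s <= clades m k t} -> s = t.
Proof.
elim: s k t => [|l IHl r IHr] k [|l' r'] //= eq_st le_m sub_st.
- by have := leaves_gt0 l'; have := leaves_gt0 r'; lia.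
- by have := leaves_gt0 l; have := leaves_gt0 r; lia.
have head t j : leaf_range m j t \in clades m j t.
  by case: t => [|? ?]; rewrite mem_head.
have sub_l : {subset clades m k l <= clades m k (Node l' r')}.
  by move=> A Al; apply: sub_st; rewrite inE mem_cat Al orbT.
have sub_r : {subset clades m (k + leaves l) r <= clades m k (Node l' r')}.
  by move=> A Ar; apply: sub_st; rewrite inE mem_cat Ar !orbT.
have [l_gt0 r_gt0] := (leaves_gt0 l, leaves_gt0 r).
have le_l : leaves l <= leaves l'.
  by apply: clade_left_child (sub_l _ (head _ _)) => /=; lia.
have le_l' : k + leaves l' <= k + leaves l.
  by apply: clade_right_child (sub_r _ (head _ _)) => /=; lia.
have eq_l : leaves l = leaves l' by lia.
congr Node.
  apply: (IHl k) => // [|A Al]; first by lia.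
  apply: clade_left (sub_l _ Al) _; first by rewrite /= -eq_st.
  by rewrite /leaf_range -eq_l; apply: clade_sub.
apply: (IHr (k + leaves l)) => [||A Ar]; [lia | lia |].
rewrite eq_l; apply: clade_right (sub_r _ Ar) _; first by rewrite /= -eq_st.
have -> : leaf_range m (k + leaves l') r' = leaf_range m (k + leaves l) r.
  by apply/setP=> i; rewrite !inE; lia.
exact: clade_sub.
Qed.

End Clades.

(** * The comb poset *)

Section Comb.
Variable n : nat.
Implicit Types (s t : fulltree n.+1) (A B : {set 'I_n.+1}).

Lemma leaves_fulltree t : leaves t = n.+1.
Proof. by apply/eqP; case: t. Qed.

(** The subtrees compared end at the last leaf, so they are on the right arm and their right
    children are invisible in [RP]. The left children are visible and bound each other in size,
    because the hypothesis is an equivalence; then [clades_sub_eq] settles the left and induction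
    the right. *)
Lemma clades_eq_RP k (s t : bintree) :
    leaves s = leaves t -> k + leaves s = n.+1 ->
    (forall A, ord_max \notin A ->
       (A \in clades n.+1 k s) = (A \in clades n.+1 k t)) ->
  s = t.
Proof.
elim: s t k => [|l IHl r IHr] [|l' r'] k //= eq_st eq_n eqRP.
- by have := leaves_gt0 l'; have := leaves_gt0 r'; lia.
- by have := leaves_gt0 l; have := leaves_gt0 r; lia.
have [l_gt0 r_gt0] := (leaves_gt0 l, leaves_gt0 r).
have [l_gt0' r_gt0'] := (leaves_gt0 l', leaves_gt0 r').
have head j u : leaf_range n.+1 j u \in clades n.+1 j u.
  by case: u => [|? ?]; rewrite mem_head.
have le_l : leaves l <= leaves l'.
  apply: (@clade_left_child n.+1 k l l' r') => /=; [lia|lia|].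
  rewrite -eqRP; first by rewrite inE mem_cat head orbT.
  by rewrite inE /=; lia.
have le_l' : leaves l' <= leaves l.
  apply: (@clade_left_child n.+1 k l' l r) => /=; [lia|lia|].
  rewrite eqRP; first by rewrite inE mem_cat head orbT.
  by rewrite inE /=; lia.
have eq_l : leaves l = leaves l' by lia.
congr Node.
  apply: (@clades_sub_eq n.+1 k) => // [|A Al]; first by lia.
  have sub_A := clade_sub Al; apply: (@clade_left _ _ l' r').
  - by move=> /=; lia.
  - rewrite /= -eqRP; first by rewrite inE mem_cat Al orbT.
    by apply/negP=> /(subsetP sub_A); rewrite inE /=; lia.
  - by rewrite /leaf_range -eq_l.
apply: (IHr _ (k + leaves l)) => [||A nA]; [lia | lia |].
have eq_range :
    leaf_range n.+1 (k + leaves l') r' = leaf_range n.+1 (k + leaves l) r.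
  by apply/setP=> i; rewrite !inE; lia.
apply/idP/idP=> Ar; have sub_A := clade_sub Ar.
  rewrite eq_l; apply: (@clade_right _ k l' r'); rewrite ?eq_range //.
    by move=> /=; lia.
  by rewrite /= -eqRP // inE mem_cat Ar !orbT.
apply: (@clade_right _ k l r); rewrite -?eq_range -?eq_l //.
- by move=> /=; lia.
- by rewrite /= eqRP // inE mem_cat -eq_l Ar !orbT.
Qed.

Lemma RP_inj s t : RP s = RP t -> s = t.
Proof.
move=> eqRP; apply: val_inj; apply: (@clades_eq_RP 0) => /=.
- by rewrite !leaves_fulltree.
- by rewrite leaves_fulltree.
by move=> A nA; move/setP/(_ A): eqRP; rewrite !inE nA !andbT.
Qed.

Lemma set1_RP t i : i != ord_max -> [set i] \in RP t.
Proof.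
move=> neq_i; rewrite inE clades_set1 ?inE 1?eq_sym //=.
by rewrite leaves_fulltree ltn_ord.
Qed.

(** The singletons in [RP] are the same for all trees. *)
Lemma comb_leE s t : comb_le s t = (reduced s \subset reduced t).
Proof.
apply/subsetP/subsetP=> sub_st A.
  by rewrite inE [in X in _ -> X]inE => /andP[/sub_st-> ->].
case: (boolP (#|A| == 1)) => [/cards1P[i ->]|nA1 As].
  rewrite inE in_set1 => /andP[_ neq_i].
  by apply: set1_RP; rewrite eq_sym.
have : A \in reduced s by rewrite inE As.
by move/sub_st; rewrite inE => /andP[].
Qed.

Lemma reduced_inj : injective (@reduced n).
Proof.
move=> s t eq_st; apply: RP_inj; apply/eqP; rewrite eqEsubset.
by rewrite -!/(comb_le _ _) !comb_leE eq_st subxx.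
Qed.

Lemma card_clade_right_comb j k A : k + j.+1 = n.+1 ->
  A \in clades n.+1 k (right_comb j) -> ord_max \notin A -> #|A| = 1.
Proof.
elim: j k => [|j IH] k eq_n.
  by rewrite inE => /eqP-> _; rewrite card_leaf_range //= eq_n.
rewrite clades_Node => /or3P[/eqP->|/=|cl_A nA]; last 1 first.
- by apply: IH cl_A nA => /=; lia.
- by rewrite inE /= (eqP (leaves_right_comb j)); lia.
- by rewrite inE => /eqP-> _; rewrite card_leaf_range //=; lia.
Qed.

Lemma reduced_RCT : reduced (RCT n) = set0.
Proof.
apply/setP=> A; rewrite !inE; apply/negP=> /andP[/andP[clade_A nA] /negP[]].
by rewrite (card_clade_right_comb _ clade_A).
Qed.

(** At the shared leaf set [B], the subtree of [s] has its leaf sets among those of the subtree of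
    [t], so by [clades_sub_eq] the two subtrees coincide, and every leaf set of [t] inside [B]
    occurs in [s]. *)
Lemma reduced_ideal s t A B : reduced s \subset reduced t ->
  B \in reduced s -> A \in reduced t -> A \subset B -> A \in reduced s.
Proof.
move=> sub_st Bs At sub_AB.
have {}sub_st : RP s \subset RP t by rewrite -/(comb_le s t) comb_leE.
have RPBs : B \in RP s by move: Bs; rewrite inE => /andP[].
move: RPBs (subsetP sub_st _ RPBs); rewrite !inE.
move=> /andP[cl_Bs nB] /andP[cl_Bt _].
have [|k1 [s1 [le1 eq_B1 mem_s1]]] := clade_subtree _ cl_Bs.
  by rewrite leaves_fulltree.
have [|k2 [t1 [le2 eq_B2 mem_t1]]] := clade_subtree _ cl_Bt.
  by rewrite leaves_fulltree.
have := leaf_range_sub (k' := k2) (t' := t1) le1; rewrite -eq_B1 -eq_B2 subxx.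
have := leaf_range_sub (k' := k1) (t' := s1) le2; rewrite -eq_B1 -eq_B2 subxx.
move=> /(_ isT)[le_k1 le_l1] /(_ isT)[le_k2 le_l2].
have eq_k : k1 = k2 by lia.
have eq_s1 : s1 = t1.
  apply: (@clades_sub_eq n.+1 k1) => //; first by lia.
  (* Sets inside [B] miss the last leaf, so the inclusion of [RP] controls all of them. *)
  move=> C; rewrite {2}eq_k mem_s1 mem_t1 => /andP[cl_C sub_C].
  rewrite sub_C andbT; have : C \in RP s.
    by rewrite inE cl_C; apply: contra nB; apply: (subsetP sub_C).
  by move/(subsetP sub_st); rewrite inE => /andP[].
move: At; rewrite inE => /andP[]; rewrite inE => /andP[cl_A nA] ->.
rewrite nA !andbT.
have : A \in clades n.+1 k2 t1 by rewrite mem_t1 cl_A.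
by rewrite -eq_k -eq_s1 mem_s1 => /andP[].
Qed.

End Comb.

(** * The pruned tree map below a fixed permutation *)

Section PrunedTreeMap.
Variable n : nat.
Implicit Types (u v w : {perm 'I_n}) (i j k y : 'I_n) (t : fulltree n.+1).
Implicit Type D : {set 'I_n}.

Lemma reducedE w : reduced (ptmap w) = named w @: P_lab w.
Proof. by apply/setP=> A; apply/mem_reduced/imsetP. Qed.

(** A leaf is in the subtree at [j] iff all labels in its window are, so the labels of the subtree
    determine its leaves. *)
Lemma named_eq v w j :
  (forall k, P_le v k j = P_le w k j) -> named v j = named w j.
Proof.
have sub v' w' : (forall k, P_le v' k j = P_le w' k j) ->
    named v' j \subset named w' j.
  move=> eq_le; apply/subsetP=> l /namedP lj; apply/namedP=> y yl.
  have : P_le v' y j by apply/P_leP=> x xy; apply: lj; lia.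
  by rewrite eq_le => /P_leP; apply; lia.
by move=> eq_le; apply/eqP; rewrite eqEsubset !sub.
Qed.

Lemma P_lab_edelman v w : edelman_le v w ->
  P_lab v = Jmap (P_lab w) (fdual w) (inversions v).
Proof.
rewrite edelman_leE => /inversion_idealP[sub_vw ideal_v].
apply/setP=> j; rewrite [RHS]inE.
apply/P_labP/andP=> [[i Iij]|[_ Ij]]; last first.
  by exists (fdual w j).1.
have Pj : j \in P_lab w by apply/P_labP; exists i; apply: (subsetP sub_vw).
have [fj min_f] := fdualP Pj; split=> //.
by apply: ideal_v Iij fj (min_f _ (subsetP sub_vw _ Iij)) (leqnn _).
Qed.

Lemma P_le_edelman v w j k : edelman_le v w -> j \in P_lab v ->
  P_le v k j = P_le w k j.
Proof.
move=> le_vw; rewrite (P_lab_edelman le_vw) inE => /andP[Pj].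
have [_ min_f] := fdualP Pj.
have : (fdual w j).2 = j by [].
move: min_f; case: (fdual w j) => i j' /= min_i -> {j'} Iij.
move: le_vw; rewrite edelman_leE => /inversion_idealP[sub_vw ideal_v].
have eq_pos y : y < i -> (pos v j <= pos v y) = (pos w j <= pos w y).
  move=> ltyi; have [ltyj|ltjy|/ord_inj->] := ltngtP y j;
    last by rewrite !leqnn.
    have lt_pos u : (pos u j <= pos u y) = (pos u j < pos u y).
      by rewrite ltn_pos -val_eqE gtn_eqF.
    rewrite !lt_pos !pos_inversions //.
    apply/idP/idP=> [/(subsetP sub_vw)//|Ijy].
    apply: (ideal_v _ _ _ _ Iij Ijy).
      by move: Iij; rewrite mem_inversions => /andP[/ltnW].
    by move: Ijy; rewrite mem_inversions => /andP[_ /ltnW].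
  rewrite (leqNgt (pos v j)) (leqNgt (pos w j)) !pos_inversions //.
  have nIw : (y, j) \notin inversions w.
    by apply/negP=> /min_i; rewrite leqNgt ltyi.
  by rewrite nIw; apply: contra nIw; apply: (subsetP sub_vw).
have Iij_w := subsetP sub_vw _ Iij.
move: Iij Iij_w; rewrite !mem_inversions => /andP[ltji lt_v] /andP[_ lt_w].
(* If [k >= i], the value [i] lies between [j] and [k] and precedes [j] in both permutations, which
   contradicts [H]. If [k < i], all values between [j] and [k] are below [i], where [eq_pos]
   applies. *)
apply/P_leP/P_leP=> H y yk.
  rewrite -eq_pos ?H //.
  by case: (ltnP k i) => [|leik]; [lia | have := H i; lia].
rewrite eq_pos ?H //.
by case: (ltnP k i) => [|leik]; [lia | have := H i; lia].
Qed.

Lemma reduced_edelman v w : edelman_le v w -> reduced (ptmap v) =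
  named w @: Jmap (P_lab w) (fdual w) (inversions v).
Proof.
move=> le_vw; rewrite reducedE -P_lab_edelman //; apply: eq_in_imset => j Pj.
by apply: named_eq => k; apply: P_le_edelman.
Qed.

Lemma Jmap_edelman v w : edelman_le v w ->
  Jmap (P_lab w) (fdual w) (inversions v) \in J (P_lab w) (P_le w).
Proof.
by rewrite edelman_leE; apply: Jmap_ideal; apply: fdual_order_preserving.
Qed.

Lemma ptmap_le v w : edelman_le v w -> comb_le (ptmap v) (ptmap w).
Proof.
move=> le_vw; rewrite comb_leE (reduced_edelman le_vw) reducedE.
by apply: imsetS; apply/subsetP=> j; rewrite inE => /andP[].
Qed.

Lemma perm_of_key (key : 'I_n -> nat) : injective key ->
  exists v, forall i j, (pos v i <= pos v j) = (key i <= key j).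
Proof.
move=> key_inj; pose rank i := #|[set j | key j < key i]|.
have lt_rank i j : key i < key j -> rank i < rank j.
  move=> lt_ij; apply: proper_card; rewrite properE; apply/andP; split.
    by apply/subsetP=> k; rewrite !inE => /ltn_trans; apply.
  by apply/subsetPn; exists i; rewrite inE // ltnn.
have rank_lt i : rank i < n.
  rewrite -[X in _ < X]card_ord -cardsT; apply: proper_card.
  by rewrite properT; apply/eqP=> /setP/(_ i); rewrite !inE ltnn.
have le_rank i j : (rank i <= rank j) = (key i <= key j).
  apply/idP/idP; first by apply: contraTT; rewrite -!ltnNge; apply: lt_rank.
  by rewrite leq_eqVlt => /predU1P[/key_inj->//|/lt_rank/ltnW].
pose f i := Ordinal (rank_lt i).
have f_inj : injective f.
  move=> i j [eq_r]; apply: key_inj; apply/eqP.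
  by rewrite eqn_leq -!le_rank eq_r leqnn.
(* [pos v] reads the inverse of [v], so [v] is the inverse of the ranking permutation. *)
by exists (perm f_inj)^-1%g => i j; rewrite invgK !permE le_rank.
Qed.

Lemma P_lab_le w j k : j \in P_lab w -> P_le w k j -> k \in P_lab w.
Proof.
case/P_labP=> i; rewrite mem_inversions => /andP[ltji lt_pos] /P_leP le_kj.
apply/P_labP; exists i; rewrite mem_inversions.
by have := le_kj i; have := le_kj k; lia.
Qed.

(** The tree with ideal [D] is the image of the permutation that lists the
    values outside [D] increasingly, then those in [D] in the order of [w]: the
    former end up on the right arm, and the subtrees at the latter are those of
    [T_w]. *)
Lemma ideal_tree w D : D \in J (P_lab w) (P_le w) ->
  exists v, reduced (ptmap v) = named w @: D.
Proof.
case/idealP=> sub_D ideal_D.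
(* The shift by [n] exceeds every label and so places [D] after all other values. *)
pose key j := if j \in D then n + pos w j else j.
have key_inj : injective key.
  move=> i j; rewrite /key; case: ifP; case: ifP => // _ _.
  - by move/addnI/pos_inj.
  - by move=> eq_j; have := ltn_ord j; lia.
  - by move=> eq_i; have := ltn_ord i; lia.
  - exact: ord_inj.
have [v le_v] := perm_of_key key_inj.
exists v; rewrite reducedE; have -> : P_lab v = D.
  apply/setP=> j; apply/P_labP/idP=> [[i]|Dj].
    rewrite mem_inversions !ltnNge le_v /key; case: ifP => //.
    by case: ifP => _ _; have := ltn_ord j; lia.
  have /P_labP[i] := subsetP sub_D _ Dj; exists i; move: p.
  rewrite !mem_inversions (ltnNge (pos v i)) le_v /key Dj.
  by case: ifP => _; have := ltn_ord i; lia.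
apply: eq_in_imset => j Dj; apply: named_eq => k.
apply/P_leP/P_leP=> H y yk; last first.
  have Dy : y \in D.
    apply: (ideal_D j) => //; last by apply/P_leP=> x xy; apply: H; lia.
    apply: P_lab_le (subsetP sub_D _ Dj) _.
    by apply/P_leP=> x xy; apply: H; lia.
  by rewrite le_v /key Dy Dj leq_add2l H.
have := H y yk; rewrite le_v /key Dj; case: ifP => _.
  by rewrite leq_add2l.
by have := ltn_ord y; lia.
Qed.

Lemma ideal_of_treeE w t : comb_le t (ptmap w) ->
  reduced t = named w @: [set j in P_lab w | named w j \in reduced t].
Proof.
rewrite comb_leE => sub_t; apply/setP=> A; apply/idP/imsetP=> [At|[j]].
  have /mem_reduced[j Pj eq_A] := subsetP sub_t _ At.
  by exists j; rewrite // inE Pj -eq_A.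
by rewrite inE => /andP[_ +] ->.
Qed.

Lemma ideal_of_tree w t : comb_le t (ptmap w) ->
  [set j in P_lab w | named w j \in reduced t] \in J (P_lab w) (P_le w).
Proof.
rewrite comb_leE => sub_t; apply/idealP; split.
  by apply/subsetP=> j; rewrite inE => /andP[].
move=> j k /setIdP[_ tj] Pk; rewrite -named_subset => sub_kj.
apply/setIdP; split=> //; apply: reduced_ideal sub_t tj _ sub_kj.
by apply/mem_reduced; exists k.
Qed.

End PrunedTreeMap.

(** * The duality diagram and the lattice morphism *)

Section Duality.
Variable n : nat.
Implicit Types (u v w : {perm 'I_n}) (t : fulltree n.+1) (D : {set 'I_n}).

Lemma ideal_comb_iso w :
  exists phi : {set 'I_n} -> fulltree n.+1,
    order_iso (mem (J (P_lab w) (P_le w))) (@inclusion _)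
      (interval (@comb_le n) (RCT n) (ptmap w)) (@comb_le n) phi /\
    forall D, D \in J (P_lab w) (P_le w) -> reduced (phi D) = named w @: D.
Proof.
(* Finite choice selects one permutation per ideal; sets that are not ideals receive the dummy
   [w]. *)
have /fin_all_exists[f red_f] : forall D, exists v,
    D \in J (P_lab w) (P_le w) -> reduced (ptmap v) = named w @: D.
  move=> D; case: (boolP (D \in J _ _)) => [/ideal_tree[v]|_].
    by exists v.
  by exists w.
exists (fun D => ptmap (f D)); split=> //.
split=> [D JD|D E JD JE eq_p|t|D E JD JE].
- have /idealP[sub_D _] := JD.
  by rewrite inE !comb_leE reduced_RCT sub0set red_f // reducedE imsetS.
- by apply: (imset_inj (@named_inj _ w)); rewrite -!red_f // eq_p.
- rewrite inE => /andP[_ le_t]; have JD := ideal_of_tree le_t.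
  by exists (Jmap (P_lab w) (named w) (reduced t)) => //;
    apply: reduced_inj; rewrite red_f // -ideal_of_treeE.
- by rewrite comb_leE !red_f // subset_imset_inj //; apply: named_inj.
Qed.

Lemma Jmap_reduced v w : edelman_le v w ->
  Jmap (P_lab w) (named w) (reduced (ptmap v)) =
  Jmap (P_lab w) (fdual w) (inversions v).
Proof.
move=> le_vw; apply: (imset_inj (@named_inj _ w)).
by rewrite -(ideal_of_treeE (ptmap_le le_vw)) (reduced_edelman le_vw).
Qed.

Lemma comb_le_Jmap w s t : comb_le s (ptmap w) -> comb_le t (ptmap w) ->
  comb_le s t = (Jmap (P_lab w) (named w) (reduced s) \subset
                 Jmap (P_lab w) (named w) (reduced t)).
Proof.
move=> /ideal_of_treeE eq_s /ideal_of_treeE eq_t.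
rewrite comb_leE eq_s eq_t subset_imset_inj -?eq_s -?eq_t //.
exact: named_inj.
Qed.

Lemma ptmap_lattice_morphism u w : edelman_le u w ->
  lattice_morphism (interval (@edelman_le n) u w) (@edelman_le n)
    (interval (@comb_le n) (ptmap u) (ptmap w)) (@comb_le n) (@ptmap n).
Proof.
move=> le_uw; set A := interval _ _ _; set B := interval _ _ _.
(* [h t] is the ideal of P_{T_w} that belongs to [t]. In these coordinates [ptmap] becomes
   [Jmap (P_lab w) (fdual w)] on inversion sets, which commutes with both set operations. *)
pose h t := Jmap (P_lab w) (named w) (reduced t).
have AP v : v \in A = edelman_le u v && edelman_le v w by [].
have BP t : t \in B = comb_le (ptmap u) t && comb_le t (ptmap w) by [].
have A_le x y : x \in A -> y \in A ->
    edelman_le x y = (inversions x \subset inversions y).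
  rewrite !AP => /andP[_ le_xw] /andP[_ le_yw].
  by rewrite (edelman_le_inversions le_xw le_yw).
have A_ideal (D : {set 'I_n * 'I_n}) :
    inversions u \subset D -> D \in J (inversions w) (inversion_le w) ->
    exists2 z, z \in A & inversions z = D.
  move=> sub_D /ideal_inversions[z le_z eq_z]; exists z => //.
  by rewrite AP le_z andbT -(edelman_le_inversions le_uw le_z) eq_z.
have A_sub x : x \in A -> inversions u \subset inversions x.
  by rewrite AP => /andP[le_ux le_xw]; rewrite (edelman_le_inversions le_uw).
have A_J x : x \in A -> inversions x \in J (inversions w) (inversion_le w).
  by rewrite AP => /andP[_]; rewrite edelman_leE.
have AI x y : x \in A -> y \in A ->
    exists2 z, z \in A & inversions z = inversions x :&: inversions y.
  move=> Ax Ay; apply: A_ideal; first by rewrite subsetI !A_sub.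
  by apply: idealI; apply: A_J.
have AU x y : x \in A -> y \in A ->
    exists2 z, z \in A & inversions z = inversions x :|: inversions y.
  move=> Ax Ay; apply: A_ideal; last by apply: idealU; apply: A_J.
  exact: subset_trans (A_sub _ Ax) (subsetUl _ _).
have B_le s t : s \in B -> t \in B -> comb_le s t = (h s \subset h t).
  by rewrite !BP => /andP[_ le_sw] /andP[_ le_tw]; apply: comb_le_Jmap.
have le_p := ptmap_le le_uw.
have B_ideal D : h (ptmap u) \subset D -> D \in J (P_lab w) (P_le w) ->
    exists2 t, t \in B & h t = D.
  move=> sub_D JD; have [phi [[phi_int _ _ _] red_phi]] := ideal_comb_iso w.
  have := phi_int D JD; rewrite inE => /andP[_ le_phi].
  have h_phi : h (phi D) = D.
    apply: (imset_inj (@named_inj _ w)); rewrite -(red_phi _ JD).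
    by rewrite -ideal_of_treeE.
  exists (phi D); rewrite // BP le_phi (comb_le_Jmap le_p le_phi) -!/(h _).
  by rewrite h_phi sub_D.
have B_sub t : t \in B -> h (ptmap u) \subset h t.
  by rewrite BP => /andP[le_ut le_tw]; rewrite /h -comb_le_Jmap.
have B_J t : t \in B -> h t \in J (P_lab w) (P_le w).
  by rewrite BP => /andP[_]; apply: ideal_of_tree.
have BI s t : s \in B -> t \in B -> exists2 z, z \in B & h z = h s :&: h t.
  move=> Bs Bt; apply: B_ideal; first by rewrite subsetI !B_sub.
  by apply: idealI; apply: B_J.
have BU s t : s \in B -> t \in B -> exists2 z, z \in B & h z = h s :|: h t.
  move=> Bs Bt; apply: B_ideal; last by apply: idealU; apply: B_J.
  exact: subset_trans (B_sub _ Bs) (subsetUl _ _).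
have h_ptmap v : v \in A ->
    h (ptmap v) = Jmap (P_lab w) (fdual w) (inversions v).
  by rewrite AP => /andP[_]; apply: Jmap_reduced.
have ptmap_B v : v \in A -> ptmap v \in B.
  move=> Av; rewrite BP; move: (Av); rewrite AP => /andP[le_uv le_vw].
  by rewrite !ptmap_le.
split=> //.
- exact: is_lattice_set A_le AI AU.
- exact: is_lattice_set B_le BI BU.
- move=> x y z Ax Ay /(is_meet_set A_le AI _ Ax Ay)[Az eq_z].
  apply/(is_meet_set B_le BI _ (ptmap_B _ Ax) (ptmap_B _ Ay)).
  split; first exact: ptmap_B.
  by rewrite !h_ptmap // eq_z JmapI.
- move=> x y z Ax Ay /(is_join_set A_le AU _ Ax Ay)[Az eq_z].
  apply/(is_join_set B_le BU _ (ptmap_B _ Ax) (ptmap_B _ Ay)).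
  split; first exact: ptmap_B.
  by rewrite !h_ptmap // eq_z JmapU.
Qed.

End Duality.

Theorem theorem6p9 (n : nat) :
  (forall w : {perm 'I_n},
    [/\ (* the labels name the elements of the reduced pruned poset of T_w *)
        order_iso (mem (P_lab w)) (P_le w)
          (mem (reduced (ptmap w))) (@inclusion _) (named w),
        (* [e, w] is isomorphic to J (I(w)) via v |-> I(v) *)
        order_iso [pred v | edelman_le v w] (@edelman_le n)
          (mem (J (inversions w) (inversion_le w))) (@inclusion _)
          (@inversions n),
        order_preserving (mem (P_lab w)) (P_le w)
          (mem (inversions w)) (inversion_le w) (fdual w),
        (* the diagram *)
        exists phi : {set 'I_n} -> fulltree n.+1,
          [/\ order_iso (mem (J (P_lab w) (P_le w))) (@inclusion _)
                (interval (@comb_le n) (RCT n) (ptmap w)) (@comb_le n) phi,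
              forall D : {set 'I_n}, D \in J (P_lab w) (P_le w) ->
                reduced (phi D) = [set named w j | j in D]
            & forall v : {perm 'I_n}, edelman_le v w ->
                phi (Jmap (P_lab w) (fdual w) (inversions v)) = ptmap v]
      & forall v : {perm 'I_n}, edelman_le v w ->
          [/\ comb_le (ptmap v) (ptmap w),
              Jmap (P_lab w) (fdual w) (inversions v)
                \in J (P_lab w) (P_le w)
            & reduced (ptmap v) =
                [set named w j
                   | j in Jmap (P_lab w) (fdual w) (inversions v)]]])
  /\
  (forall u w : {perm 'I_n}, edelman_le u w ->
     lattice_morphism (interval (@edelman_le n) u w) (@edelman_le n)
       (interval (@comb_le n) (ptmap u) (ptmap w)) (@comb_le n) (@ptmap n)).
Proof.
split=> [w|u w]; last exact: ptmap_lattice_morphism.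
split; first exact: named_order_iso.
- exact: edelman_order_iso.
- exact: fdual_order_preserving.
- have [phi [iso_phi red_phi]] := ideal_comb_iso w.
  exists phi; split=> // v le_vw; apply: reduced_inj.
  by rewrite red_phi ?Jmap_edelman // (reduced_edelman le_vw).
- move=> v le_vw; split; first exact: ptmap_le.
    exact: Jmap_edelman.
  exact: reduced_edelman.
Qed.
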